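(* The NCE equation system (consisting of the two differential-algebraic systems (I) and (II) given in the context) has a solution on $[0,T]$ if and only if the system of master equations (consisting of (M0) and (M$\kappa$), $1\le\kappa\le K$, given in the context) has a quadratic solution. If their solutions exist, they are unique, and moreover $$P_k=\mathbf{P}_k^\dagger,\qquad s_k=\mathbf{s}_k^\dagger,\qquad k=0,1,\dots,K,$$ where $P_k,s_k$ are components of the solution of the NCE equation system and $\mathbf{P}_k^\dagger,\mathbf{s}_k^\dagger$ are the coefficient functions of the quadratic solution $(V_0,V_1,\dots,V_K)$ of the master equations.
   Context: **Data.** $T>0$, $\rho\ge0$, $n,n_1,n_2,K$ are positive integers. $\pi=(\pi_1,\dots,\pi_K)$ is a probability (row) vector with $\min_k\pi_k>0$. The constant matrices $A_0,F_0,A_1,\dots,A_K,F,G\in\mathbb{R}^{n\times n}$, $B_0,B\in\mathbb{R}^{n\times n_1}$, $D_0,D\in\mathbb{R}^{n\times n_2}$, $\Gamma_0,\Gamma_{0f},\Gamma_1,\Gamma_{1f},\Gamma_2,\Gamma_{2f}\in\mathbb{R}^{n\times n}$, vectors $\eta_0,\eta_{0f},\eta,\eta_f\in\mathbb{R}^n$, symmetric $Q_0,Q_{0f},Q,Q_f\in\mathbb{R}^{n\times n}$ that are positive semidefinite, and symmetric positive definite $R_0,R\in\mathbb{R}^{n_1\times n_1}$ are given. $I$ is an identity matrix, $|z|_M^2=z^TMz$, and $\otimes$ is the Kronecker product. Set $F_0^\pi=\pi\otimes F_0$, $F^\pi=\pi\otimes F$, $\Gamma_0^\pi=\pi\otimes\Gamma_0$,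 $\Gamma_{0f}^\pi=\pi\otimes\Gamma_{0f}$, $\Gamma_2^\pi=\pi\otimes\Gamma_2$, $\Gamma_{2f}^\pi=\pi\otimes\Gamma_{2f}$ (all in $\mathbb{R}^{n\times nK}$). **NCE equation system.** Unknowns: continuous functions on $[0,T]$ - $P_0(t)\in\mathbb{R}^{n(K+1)\times n(K+1)}$, $P_\kappa(t)\in\mathbb{R}^{n(K+2)\times n(K+2)}$ ($1\le\kappa\le K$), $\overline A(t)\in\mathbb{R}^{nK\times nK}$, $\overline G(t)\in\mathbb{R}^{nK\times n}$; - $s_0(t)\in\mathbb{R}^{n(K+1)}$, $s_\kappa(t)\in\mathbb{R}^{n(K+2)}$ ($1\le\kappa\le K$), $\overline m(t)\in\mathbb{R}^{nK}$. Partition $\overline A,\overline G,\overline m$ into $K$ block rows $\overline A_\kappa\in\mathbb{R}^{n\times nK}$, $\overline G_\kappa\in\mathbb{R}^{n\times n}$, $\overline m_\kappa\in\mathbb{R}^n$. Partition $P_\kappa=(P_{\kappa,jl})_{1\le j,l\le3}$ with $P_{\kappa,11},P_{\kappa,22}\in\mathbb{R}^{n\times n}$, $P_{\kappa,33}\in\mathbb{R}^{nK\times nK}$. Let $\mathbf{e}_\kappa=[0,\dots,0,I_n,0,\dots,0]\in\mathbb{R}^{n\times nK}$ with $I_n$ in the $\kappa$-th $n\times n$ block. Define $$\mathbb{A}_0=\begin{bmatrix}A_0&F_0^\pi\\ \overline G&\overline A\end{bmatrix},\quad \mathbb{B}_0=\begin{bmatrix}B_0\\0_{nK\times n_1}\end{bmatrix},\quad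 \mathbb{M}_0=\begin{bmatrix}0_{n\times1}\\ \overline m\end{bmatrix},$$ $$\mathbb{A}_\kappa=\begin{bmatrix}A_\kappa&[G\ \ F^\pi]\\0_{n(K+1)\times n}&\mathbb{A}_0-\mathbb{B}_0R_0^{-1}\mathbb{B}_0^TP_0\end{bmatrix},\quad \mathbb{B}=\begin{bmatrix}B\\0_{n(K+1)\times n_1}\end{bmatrix},\quad \mathbb{M}=\begin{bmatrix}0_{n\times1}\\ \mathbb{M}_0-\mathbb{B}_0R_0^{-1}\mathbb{B}_0^Ts_0\end{bmatrix},$$ $$\mathbb{Q}_0^\pi=[I,-\Gamma_0^\pi]^TQ_0[I,-\Gamma_0^\pi],\quad \bar\eta_0^\pi=[I,-\Gamma_0^\pi]^TQ_0\eta_0,\quad \mathbb{Q}_{0f}^\pi=[I,-\Gamma_{0f}^\pi]^TQ_{0f}[I,-\Gamma_{0f}^\pi],\quad \bar\eta_{0f}^\pi=[I,-\Gamma_{0f}^\pi]^TQ_{0f}\eta_{0f},$$ $$\mathbb{Q}^\pi=[I,-\Gamma_1,-\Gamma_2^\pi]^TQ[I,-\Gamma_1,-\Gamma_2^\pi],\quad \bar\eta^\pi=[I,-\Gamma_1,-\Gamma_2^\pi]^TQ\eta,$$ $$\mathbb{Q}_f^\pi=[I,-\Gamma_{1f},-\Gamma_{2f}^\pi]^TQ_f[I,-\Gamma_{1f},-\Gamma_{2f}^\pi],\quad \bar\eta_f^\pi=[I,-\Gamma_{1f},-\Gamma_{2f}^\pi]^TQ_f\eta_f.$$ System (I): for $1\le\kappa\le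 K$, $$\rho P_0=\dot P_0+P_0\mathbb{A}_0+\mathbb{A}_0^TP_0-P_0\mathbb{B}_0R_0^{-1}\mathbb{B}_0^TP_0+\mathbb{Q}_0^\pi,\qquad P_0(T)=\mathbb{Q}_{0f}^\pi,$$ $$\rho P_\kappa=\dot P_\kappa+P_\kappa\mathbb{A}_\kappa+\mathbb{A}_\kappa^TP_\kappa-P_\kappa\mathbb{B}R^{-1}\mathbb{B}^TP_\kappa+\mathbb{Q}^\pi,\qquad P_\kappa(T)=\mathbb{Q}_f^\pi,$$ $$\overline A_\kappa=(A_\kappa-BR^{-1}B^TP_{\kappa,11})\mathbf{e}_\kappa+F^\pi-BR^{-1}B^TP_{\kappa,13},\qquad \overline G_\kappa=G-BR^{-1}B^TP_{\kappa,12}.$$ System (II): for $1\le\kappa\le K$, $$\rho s_0=\dot s_0+(\mathbb{A}_0^T-P_0\mathbb{B}_0R_0^{-1}\mathbb{B}_0^T)s_0+P_0\mathbb{M}_0-\bar\eta_0^\pi,\qquad s_0(T)=-\bar\eta_{0f}^\pi,$$ $$\rho s_\kappa=\dot s_\kappa+(\mathbb{A}_\kappa^T-P_\kappa\mathbb{B}R^{-1}\mathbb{B}^T)s_\kappa+P_\kappa\mathbb{M}-\bar\eta^\pi,\qquad s_\kappa(T)=-\bar\eta_f^\pi,$$ $$\overline m_\kappa=-BR^{-1}\mathbb{B}^Ts_\kappa.$$ A solution of the NCE equation system is a set of continuous functions $(P_0,\dots,P_K,\overline A,\overline G,s_0,\dots,s_K,\overline m)$ on $[0,T]$, with $P_0(t)\in\mathbb{R}^{n(K+1)\times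 n(K+1)}$, $P_\kappa(t)\in\mathbb{R}^{n(K+2)\times n(K+2)}$, $\overline A(t)\in\mathbb{R}^{nK\times nK}$, $\overline G(t)\in\mathbb{R}^{nK\times n}$, $s_0(t)\in\mathbb{R}^{n(K+1)}$, $s_\kappa(t)\in\mathbb{R}^{n(K+2)}$ ($1\le\kappa\le K$) and $\overline m(t)\in\mathbb{R}^{nK}$, satisfying (I) and (II) on $[0,T]$. **Master equations.** $\mathcal{P}_2(\mathbb{R}^n)$ is the set of probability measures on $\mathbb{R}^n$ with finite second moment. For $\mu=(\mu_1,\dots,\mu_K)\in\mathcal{P}_2(\mathbb{R}^n)^K$ put $\bar z_\kappa=\int y\,\mu_\kappa(dy)$ and $\bar z=\bar z^\mu=[\bar z_1^T,\dots,\bar z_K^T]^T\in\mathbb{R}^{nK}$. For a function $V$ of $\mu$ (and other variables), $(\partial_{\mu_l}V)(\cdot,\mu;y_l)$ is the linear functional derivative $\frac{\delta V}{\delta\mu_l}$ with respect to the $l$-th measure, i.e. $\frac{d}{d\epsilon}\big|_{\epsilon=0^+}V(\cdot,\mu_l+\epsilon(\nu-\mu_l),\cdot)=\int(\partial_{\mu_l}V)(\cdot,\mu;y)(\nu-\mu_l)(dy)$ (only its derivatives in $y_l$ are used, so an additive constant is immaterial). Gradients $\partial_x V$ are column vectors, $\partial_x^TV=(\partial_xV)^T$ (and $\partial^T_{y_l}$ is likewise the transposed gradient), $\partial_{xx}V$ is the Hessian; $\partial_{y_l}V_l(t,y_l,x_0,\mu)$ is the gradient of $V_l$ in its second argument.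 The unknowns are $V_0(t,x_0,\mu)$ and $V_\kappa(t,z_\kappa,x_0,\mu)$, $1\le\kappa\le K$, for $t\in[0,T]$, $x_0,z_\kappa\in\mathbb{R}^n$, $\mu\in\mathcal{P}_2(\mathbb{R}^n)^K$. (M0): $$\begin{aligned}-\partial_tV_0+\rho V_0=\ &\partial_{x_0}^TV_0(A_0x_0+F_0^\pi\bar z^\mu)-\tfrac14\partial_{x_0}^TV_0B_0R_0^{-1}B_0^T\partial_{x_0}V_0+|x_0-\Gamma_0^\pi\bar z^\mu-\eta_0|_{Q_0}^2+\tfrac12\mathrm{Tr}(\partial_{x_0x_0}V_0D_0D_0^T)\\&+\sum_{l=1}^K\int\partial_{y_l}^T(\partial_{\mu_l}V_0)(t,x_0,\mu;y_l)(A_ly_l+Gx_0+F^\pi\bar z^\mu)\mu_l(dy_l)\\&-\sum_{l=1}^K\int\tfrac12\partial_{y_l}^T(\partial_{\mu_l}V_0)(t,x_0,\mu;y_l)BR^{-1}B^T\partial_{y_l}V_l(t,y_l,x_0,\mu)\mu_l(dy_l)\\&+\sum_{l=1}^K\int\tfrac12\mathrm{Tr}[\partial_{y_ly_l}(\partial_{\mu_l}V_0)(t,x_0,\mu;y_l)DD^T]\mu_l(dy_l),\end{aligned}$$ with $V_0(T,x_0,\mu)=|x_0-\Gamma_{0f}^\pi\bar z^\mu-\eta_{0f}|_{Q_{0f}}^2$. (M$\kappa$), $1\le\kappa\le K$: $$\begin{aligned}-\partial_tV_\kappa+\rho V_\kappa=\ &\partial_{x_0}^TV_\kappa(A_0x_0+F_0^\pi\bar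 z^\mu)-\tfrac12\partial_{x_0}^TV_\kappa B_0R_0^{-1}B_0^T\partial_{x_0}V_0+\tfrac12\mathrm{Tr}(\partial_{x_0x_0}V_\kappa D_0D_0^T)\\&+\partial_{z_\kappa}^TV_\kappa(A_\kappa z_\kappa+Gx_0+F^\pi\bar z^\mu)-\tfrac14\partial_{z_\kappa}^TV_\kappa BR^{-1}B^T\partial_{z_\kappa}V_\kappa\\&+|z_\kappa-\Gamma_1x_0-\Gamma_2^\pi\bar z^\mu-\eta|_Q^2+\tfrac12\mathrm{Tr}(\partial_{z_\kappa z_\kappa}V_\kappa DD^T)\\&+\sum_{l=1}^K\int\partial_{y_l}^T(\partial_{\mu_l}V_\kappa)(t,z_\kappa,x_0,\mu;y_l)(A_ly_l+Gx_0+F^\pi\bar z^\mu)\mu_l(dy_l)\\&-\sum_{l=1}^K\int\tfrac12\partial_{y_l}^T(\partial_{\mu_l}V_\kappa)(t,z_\kappa,x_0,\mu;y_l)BR^{-1}B^T\partial_{y_l}V_l(t,y_l,x_0,\mu)\mu_l(dy_l)\\&+\sum_{l=1}^K\int\tfrac12\mathrm{Tr}[\partial_{y_ly_l}(\partial_{\mu_l}V_\kappa)(t,z_\kappa,x_0,\mu;y_l)DD^T]\mu_l(dy_l),\end{aligned}$$ with $V_\kappa(T,z_\kappa,x_0,\mu)=|z_\kappa-\Gamma_{1f}x_0-\Gamma_{2f}^\pi\bar z^\mu-\eta_f|_{Q_f}^2$. **Quadratic solution.** With $\xi_0=[x_0^T,\bar z^T]^T$ and $\xi_\kappa=[z_\kappa^T,x_0^T,\bar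 z^T]^T$, a quadratic solution is a solution $(V_0,\dots,V_K)$ of (M0), (M$\kappa$) of the form $$V_0(t,x_0,\mu)=\xi_0^T\mathbf{P}_0^\dagger(t)\xi_0+2\mathbf{s}_0^{\dagger T}(t)\xi_0+\mathbf{r}_0^\dagger(t),\qquad V_\kappa(t,z_\kappa,x_0,\mu)=\xi_\kappa^T\mathbf{P}_\kappa^\dagger(t)\xi_\kappa+2\mathbf{s}_\kappa^{\dagger T}(t)\xi_\kappa+\mathbf{r}_\kappa^\dagger(t),$$ where $\mathbf{P}_0^\dagger,\mathbf{P}_\kappa^\dagger$ are symmetric-matrix valued and all coefficient functions are differentiable on $[0,T]$. *)

(* Defs.v *)
From HB Require Import structures.
From mathcomp Require Import all_boot all_order all_algebra.
From mathcomp Require Import mxtens.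
From mathcomp Require Import all_classical all_reals all_analysis.
From mathcomp Require Import measurable_realfun.

Set Implicit Arguments.
Unset Strict Implicit.
Unset Printing Implicit Defensive.

Import Order.TTheory GRing.Theory Num.Theory.
Import numFieldNormedType.Exports.
Local Open Scope classical_set_scope.
Local Open Scope ring_scope.

(* ℝ^{nK} is ['cV[R]_(stack n K)]; the sum (rather than [K * n]) lets the
   library's block operations [\mxrow], [\mxcol], [submxcol] apply. *)
Notation stack n K := (\sum_(k < K) n)%N (only parsing).

Section LinearAlgebra.
Context {R : realType}.

Definition sdot n (u v : 'cV[R]_n) : R := (u^T *m v) 0 0.

Definition sqnorm n (M : 'M[R]_n) (z : 'cV[R]_n) : R := sdot z (M *m z).

Definition psdmx n (M : 'M[R]_n) : Prop :=
  M^T = M /\ forall z : 'cV[R]_n, 0 <= sqnorm M z.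

Definition pdmx n (M : 'M[R]_n) : Prop :=
  M^T = M /\ forall z : 'cV[R]_n, z != 0 -> 0 < sqnorm M z.

Lemma mul_stack n K : (K * n)%N = stack n K.
Proof. by rewrite sum_nat_const card_ord. Qed.

(* The Kronecker product p ⊗ M of a row vector p and a matrix M; the cast only
   identifies the dimensions [1 * n] and [K * n] with [n] and [stack n K]. *)
Definition kron n K (p : 'rV[R]_K) (M : 'M[R]_n) : 'M[R]_(n, stack n K) :=
  castmx (mul1n n, mul_stack n K) (p *t M).

Lemma kronE n K (p : 'rV[R]_K) (M : 'M[R]_n) :
  kron p M = \mxrow_(k < K) (p 0 k *: M).
Proof.
apply/matrixP => i j; rewrite castmxE [RHS]mxE [RHS]mxE.
set i' := cast_ord _ i; set j' := cast_ord _ j.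
have -> : i' = mxtens_index (0, i) by apply: val_inj; rewrite /= mul0n.
have -> : j' = mxtens_index (tagnat.sig1 j, tagnat.sig2 j).
  apply: val_inj => /=.
  have {1}-> : (j : nat) = tagnat.Rank (tagnat.sig1 j) (tagnat.sig2 j).
    by rewrite tagnat.sig2K.
  rewrite tagnat.RankEsum /=.
  congr (_ + _)%N; rewrite sum_nat_const; congr (_ * _)%N.
  rewrite -sum1_card -(big_ord_widen K (fun=> 1%N)) ?sum1_card ?card_ord//.
  exact: ltnW.
by rewrite tensmxE.
Qed.

Definition blockE n K (k : 'I_K) : 'M[R]_(n, stack n K) :=
  \mxrow_(l < K) (if l == k then 1%:M else 0).

Definition blockrow n K q (M : 'M[R]_(stack n K, q)) (k : 'I_K) : 'M[R]_(n, q) :=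
  submxcol (p_ := fun=> n) M k.

End LinearAlgebra.

Section Calculus.
Context {R : realType}.

(* Derivative relative to [0, T], hence one-sided at the two endpoints. *)
Definition is_deriv_on (W : normedModType R) (T : R) (f : R -> W) (t : R)
    (df : W) : Prop :=
  h^-1 *: (f (t + h) - f t) @[h --> within [set h | 0 <= t + h <= T] 0^'] --> df.

Definition derivable_on (W : normedModType R) (T : R) (f : R -> W) : Prop :=
  forall t, 0 <= t <= T -> exists df, is_deriv_on T f t df.

Definition grad n (f : 'cV[R]_n -> R) (x : 'cV[R]_n) : 'cV[R]_n :=
  \col_i 'D_(delta_mx i 0) f x.

Definition hess n (f : 'cV[R]_n -> R) (x : 'cV[R]_n) : 'M[R]_n :=
  \matrix_(i, j) 'D_(delta_mx i 0) (fun u => grad f u j 0) x.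

Definition diff1 n (f : 'cV[R]_n -> R) : Prop := forall x, differentiable f x.

Definition diff2 n (f : 'cV[R]_n -> R) : Prop :=
  diff1 f /\ forall x, differentiable (grad f) x.

End Calculus.



Section Measures.
Context {R : realType} (n : nat).

(* ℝ^n with its Borel σ-algebra *)
Definition borelV := g_sigma_algebraType (@open 'cV[R]_n).

Lemma continuous_borelV (f : 'cV[R]_n -> R) :
  continuous f -> measurable_fun setT (f : borelV -> R).
Proof.
move=> /continuousP cf.
apply: (measurability _ (RGenOpens.measurableE R)) => _ [_ [a [b ->]] <-].
rewrite setTI; apply: sub_sigma_algebra; apply: cf; exact: interval_open.
Qed.

Lemma sqnorm1E (y : 'cV[R]_n) : sqnorm 1%:M y = \sum_i y i 0 ^+ 2.
Proof.
by rewrite /sqnorm /sdot mul1mx mxE; apply: eq_bigr => i _; rewrite mxE expr2.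
Qed.

Lemma continuous_sqnorm1 : continuous (fun y : 'cV[R]_n => sqnorm 1%:M y).
Proof.
have -> : (fun y : 'cV[R]_n => sqnorm 1%:M y) = (fun y => \sum_i y i 0 ^+ 2).
  by apply/funext => y; rewrite sqnorm1E.
apply: (@continuous_big _ _ +%R 0) => [|i _ y]; first exact: add_continuous.
apply: (@continuous_comp _ _ _ (fun z : 'cV[R]_n => z i 0) (fun r : R => r ^+ 2)).
  exact: coord_continuous.
exact: exprn_continuous.
Qed.

Record P2 := MkP2 {
  P2_prob :> probability borelV R ;
  P2_moment : (\int[P2_prob]_y (sqnorm 1%:M (y : 'cV[R]_n))%:E < +oo)%E }.

Definition mean (mu : P2) : 'cV[R]_n :=
  \col_i \int[mu]_y ((y : 'cV[R]_n) i 0).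

Definition clamp01 (e : R) : R := Num.max 0 (Num.min e 1).

Lemma clamp01_ge0 e : 0 <= clamp01 e.
Proof. by rewrite /clamp01 le_max lexx. Qed.

Lemma clamp01_le1 e : 0 <= 1 - clamp01 e.
Proof. by rewrite subr_ge0 /clamp01 ge_max ler01 ge_min lexx orbT. Qed.

Definition mix_measure (e : R) (mu nu : P2) :=
  measure_add (mscale (NngNum (clamp01_le1 e)) mu)
              (mscale (NngNum (clamp01_ge0 e)) nu).

HB.instance Definition _ e mu nu := Measure.on (mix_measure e mu nu).

Lemma mix_measureT e mu nu : mix_measure e mu nu setT = 1%E.
Proof.
rewrite /mix_measure measure_addE /mscale /=.
by rewrite [X in (_ * X + _)%E]probability_setT [X in (_ + _ * X)%E]probability_setT
  !mule1 -EFinD subrK.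
Qed.

HB.instance Definition _ e mu nu :=
  Measure_isProbability.Build _ _ _ (mix_measure e mu nu) (mix_measureT e mu nu).

Lemma mix_moment e mu nu :
  (\int[mix_measure e mu nu]_y (sqnorm 1%:M (y : 'cV[R]_n))%:E < +oo)%E.
Proof.
have m1 : measurable_fun setT (fun y : borelV => (sqnorm 1%:M (y : 'cV[R]_n))%:E).
  apply/measurable_EFinP; apply: continuous_borelV; exact: continuous_sqnorm1.
have p1 (y : borelV) : setT y -> (0 <= (sqnorm 1%:M (y : 'cV[R]_n))%:E)%E.
  by rewrite lee_fin sqnorm1E sumr_ge0// => i _; rewrite sqr_ge0.
rewrite ge0_integral_measure_add// !ge0_integral_mscale//.
by apply: lte_add_pinfty; apply: lte_mul_pinfty; rewrite ?lee_fin ?fin_numE//; exact: P2_moment.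
Qed.

(* (1 - e) mu + e nu; the clamping of e to [0, 1] only serves totality. *)
Definition mixP2 (e : R) (mu nu : P2) : P2 := MkP2 (mix_moment e mu nu).

Definition upd K (mu : 'I_K -> P2) (l : 'I_K) (nu : P2) : 'I_K -> P2 :=
  fun k => if k == l then nu else mu k.

(* [D] is a linear functional derivative of [U] at [mu] with respect to the
   [l]-th measure; it is determined up to an additive constant. *)
Definition is_flat_deriv K (U : ('I_K -> P2) -> R) (mu : 'I_K -> P2) (l : 'I_K)
    (D : 'cV[R]_n -> R) : Prop :=
  forall nu : P2,
    nu.-integrable setT (fun y : borelV => (D y)%:E) /\
    e^-1 * (U (upd mu l (mixP2 e (mu l) nu)) - U mu) @[e --> 0^'+] -->
      \int[nu]_y D y - \int[mu l]_y D y.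

End Measures.
Arguments borelV : clear implicits.
Arguments P2 : clear implicits.

Record mfg_data (R : realType) (n n1 n2 K : nat) := Data {
  horizon : R ;
  discount : R ;
  weight : 'rV[R]_K ;
  mA0 : 'M[R]_n ; mF0 : 'M[R]_n ;
  mA : 'I_K -> 'M[R]_n ; mF : 'M[R]_n ; mG : 'M[R]_n ;
  mB0 : 'M[R]_(n, n1) ; mB : 'M[R]_(n, n1) ;
  mD0 : 'M[R]_(n, n2) ; mD : 'M[R]_(n, n2) ;
  Gam0 : 'M[R]_n ; Gam0f : 'M[R]_n ;
  Gam1 : 'M[R]_n ; Gam1f : 'M[R]_n ;
  Gam2 : 'M[R]_n ; Gam2f : 'M[R]_n ;
  eta0 : 'cV[R]_n ; eta0f : 'cV[R]_n ;
  eta : 'cV[R]_n ; etaf : 'cV[R]_n ;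
  mQ0 : 'M[R]_n ; mQ0f : 'M[R]_n ; mQ : 'M[R]_n ; mQf : 'M[R]_n ;
  mR0 : 'M[R]_n1 ; mR : 'M[R]_n1 }.

Section Equations.
Context {R : realType} {n n1 n2 K : nat} (d : mfg_data R n n1 n2 K).

Local Notation nK := (stack n K).
Local Notation T := (horizon d).
Local Notation rho := (discount d).
Local Notation A0 := (mA0 d).
Local Notation A := (mA d).
Local Notation G := (mG d).
Local Notation B0 := (mB0 d).
Local Notation B := (mB d).
Local Notation Q0 := (mQ0 d).
Local Notation Q0f := (mQ0f d).
Local Notation Q := (mQ d).
Local Notation Qf := (mQf d).
Local Notation R0i := (invmx (mR0 d)).
Local Notation Ri := (invmx (mR d)).

Definition F0pi : 'M[R]_(n, nK) := kron (weight d) (mF0 d).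
Definition Fpi : 'M[R]_(n, nK) := kron (weight d) (mF d).
Definition Gam0pi : 'M[R]_(n, nK) := kron (weight d) (Gam0 d).
Definition Gam0fpi : 'M[R]_(n, nK) := kron (weight d) (Gam0f d).
Definition Gam2pi : 'M[R]_(n, nK) := kron (weight d) (Gam2 d).
Definition Gam2fpi : 'M[R]_(n, nK) := kron (weight d) (Gam2f d).

(* The dimensions n(K+1) and n(K+2) are split as [n + nK] and [n + (n + nK)],
   matching the block partitions of the coefficient matrices. *)
Record nce := NCE {
  P0_ : R -> 'M[R]_(n + nK) ;
  P_ : 'I_K -> R -> 'M[R]_(n + (n + nK)) ;
  Abar_ : R -> 'M[R]_nK ;
  Gbar_ : R -> 'M[R]_(nK, n) ;
  s0_ : R -> 'cV[R]_(n + nK) ;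
  s_ : 'I_K -> R -> 'cV[R]_(n + (n + nK)) ;
  mbar_ : R -> 'cV[R]_nK }.

Definition blk11 (M : 'M[R]_(n + (n + nK))) : 'M[R]_n := ulsubmx M.
Definition blk12 (M : 'M[R]_(n + (n + nK))) : 'M[R]_n := lsubmx (ursubmx M).
Definition blk13 (M : 'M[R]_(n + (n + nK))) : 'M[R]_(n, nK) :=
  rsubmx (ursubmx M).

Definition bbB0 : 'M[R]_(n + nK, n1) := col_mx B0 0.
Definition bbB : 'M[R]_(n + (n + nK), n1) := col_mx B 0.

Definition rowQ0 : 'M[R]_(n, n + nK) := row_mx 1%:M (- Gam0pi).
Definition rowQ0f : 'M[R]_(n, n + nK) := row_mx 1%:M (- Gam0fpi).
Definition rowQ : 'M[R]_(n, n + (n + nK)) :=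
  row_mx 1%:M (row_mx (- Gam1 d) (- Gam2pi)).
Definition rowQf : 'M[R]_(n, n + (n + nK)) :=
  row_mx 1%:M (row_mx (- Gam1f d) (- Gam2fpi)).

Definition bbQ0 := rowQ0^T *m Q0 *m rowQ0.
Definition bbQ0f := rowQ0f^T *m Q0f *m rowQ0f.
Definition bbQ := rowQ^T *m Q *m rowQ.
Definition bbQf := rowQf^T *m Qf *m rowQf.
Definition etab0 := rowQ0^T *m Q0 *m eta0 d.
Definition etab0f := rowQ0f^T *m Q0f *m eta0f d.
Definition etab := rowQ^T *m Q *m eta d.
Definition etabf := rowQf^T *m Qf *m etaf d.

Section Coefficients.
Variables (X : nce) (t : R).

Definition bbA0 : 'M[R]_(n + nK) := block_mx A0 F0pi (Gbar_ X t) (Abar_ X t).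
Definition bbM0 : 'cV[R]_(n + nK) := col_mx 0 (mbar_ X t).
Definition bbA (k : 'I_K) : 'M[R]_(n + (n + nK)) :=
  block_mx (A k) (row_mx G Fpi)
           0 (bbA0 - bbB0 *m R0i *m bbB0^T *m P0_ X t).
Definition bbM : 'cV[R]_(n + (n + nK)) :=
  col_mx 0 (bbM0 - bbB0 *m R0i *m bbB0^T *m s0_ X t).

End Coefficients.

Definition nce_continuous (X : nce) : Prop :=
  [/\ {within `[0, T], continuous (P0_ X)},
      forall k, {within `[0, T], continuous (P_ X k)},
      {within `[0, T], continuous (Abar_ X)} &
      {within `[0, T], continuous (Gbar_ X)}] /\
  [/\ {within `[0, T], continuous (s0_ X)},
      forall k, {within `[0, T], continuous (s_ X k)} &
      {within `[0, T], continuous (mbar_ X)}].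

Definition system_I (X : nce) : Prop :=
  [/\ forall t, 0 <= t <= T -> exists2 dP0, is_deriv_on T (P0_ X) t dP0 &
        rho *: P0_ X t = dP0 + P0_ X t *m bbA0 X t + (bbA0 X t)^T *m P0_ X t
          - P0_ X t *m bbB0 *m R0i *m bbB0^T *m P0_ X t + bbQ0,
      P0_ X T = bbQ0f,
      forall k t, 0 <= t <= T -> exists2 dP, is_deriv_on T (P_ X k) t dP &
        rho *: P_ X k t = dP + P_ X k t *m bbA X t k + (bbA X t k)^T *m P_ X k t
          - P_ X k t *m bbB *m Ri *m bbB^T *m P_ X k t + bbQ,
      forall k, P_ X k T = bbQf &
      forall k t, 0 <= t <= T ->
        blockrow (Abar_ X t) k =
          (A k - B *m Ri *m B^T *m blk11 (P_ X k t)) *m blockE n k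
          + Fpi - B *m Ri *m B^T *m blk13 (P_ X k t) /\
        blockrow (Gbar_ X t) k = G - B *m Ri *m B^T *m blk12 (P_ X k t)].

Definition system_II (X : nce) : Prop :=
  [/\ forall t, 0 <= t <= T -> exists2 ds0, is_deriv_on T (s0_ X) t ds0 &
        rho *: s0_ X t = ds0
          + ((bbA0 X t)^T - P0_ X t *m bbB0 *m R0i *m bbB0^T) *m s0_ X t
          + P0_ X t *m bbM0 X t - etab0,
      s0_ X T = - etab0f,
      forall k t, 0 <= t <= T -> exists2 ds, is_deriv_on T (s_ X k) t ds &
        rho *: s_ X k t = ds
          + ((bbA X t k)^T - P_ X k t *m bbB *m Ri *m bbB^T) *m s_ X k t
          + P_ X k t *m bbM X t - etab,
      forall k, s_ X k T = - etabf &
      forall k t, 0 <= t <= T ->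
        blockrow (mbar_ X t) k = - (B *m Ri *m bbB^T *m s_ X k t)].

Definition nce_solution (X : nce) : Prop :=
  [/\ nce_continuous X, system_I X & system_II X].

Definition nce_eq_on (X Y : nce) : Prop :=
  forall t, 0 <= t <= T ->
    [/\ P0_ X t = P0_ Y t, forall k, P_ X k t = P_ Y k t,
        Abar_ X t = Abar_ Y t & Gbar_ X t = Gbar_ Y t] /\
    [/\ s0_ X t = s0_ Y t, forall k, s_ X k t = s_ Y k t & mbar_ X t = mbar_ Y t].

Local Notation measures := ('I_K -> P2 R n).

Definition zbar (mu : measures) : 'cV[R]_nK := \mxcol_(k < K) mean (mu k).

(* [V0_ W t x0 mu] and [V_ W k t z x0 mu] *)
Record values := Values {
  V0_ : R -> 'cV[R]_n -> measures -> R ;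
  V_ : 'I_K -> R -> 'cV[R]_n -> 'cV[R]_n -> measures -> R }.

Section Transport.
Variables (W : values) (t : R) (x0 : 'cV[R]_n) (mu : measures).
Variable dU : 'I_K -> 'cV[R]_n -> R.

Definition drift_integrand (l : 'I_K) (y : 'cV[R]_n) : R :=
  sdot (grad (dU l) y) (A l *m y + mG d *m x0 + Fpi *m zbar mu).

Definition control_integrand (l : 'I_K) (y : 'cV[R]_n) : R :=
  2^-1 * sdot (grad (dU l) y)
    (B *m Ri *m B^T *m grad (fun z => V_ W l t z x0 mu) y).

Definition diffusion_integrand (l : 'I_K) (y : 'cV[R]_n) : R :=
  2^-1 * \tr (hess (dU l) y *m mD d *m (mD d)^T).

(* The sums of integrals over the population measures common to all the master
   equations, with [dU l] in the role of the functional derivative of the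
   unknown with respect to [mu l]. *)
Definition transport : R :=
  \sum_(l < K) \int[mu l]_y drift_integrand l y
  - \sum_(l < K) \int[mu l]_y control_integrand l y
  + \sum_(l < K) \int[mu l]_y diffusion_integrand l y.

Definition transport_wf : Prop :=
  forall l : 'I_K,
    [/\ diff2 (dU l),
        (mu l).-integrable setT (fun y : borelV R n => (drift_integrand l y)%:E),
        (mu l).-integrable setT (fun y : borelV R n => (control_integrand l y)%:E) &
        (mu l).-integrable setT (fun y : borelV R n => (diffusion_integrand l y)%:E)].

End Transport.

Definition master0 (W : values) : Prop :=
  (forall t x0 mu, 0 <= t <= T ->
     diff2 (fun x => V0_ W t x mu) /\
     exists dt, exists dU : 'I_K -> 'cV[R]_n -> R,
       let gx := grad (fun x => V0_ W t x mu) x0 in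
       [/\ is_deriv_on T (fun u => V0_ W u x0 mu) t dt,
           forall l, is_flat_deriv (V0_ W t x0) mu l (dU l),
           transport_wf W t x0 mu dU &
           - dt + rho * V0_ W t x0 mu =
             sdot gx (A0 *m x0 + F0pi *m zbar mu)
             - 4^-1 * sdot gx (B0 *m R0i *m B0^T *m gx)
             + sqnorm Q0 (x0 - Gam0pi *m zbar mu - eta0 d)
             + 2^-1 * \tr (hess (fun x => V0_ W t x mu) x0 *m mD0 d *m (mD0 d)^T)
             + transport W t x0 mu dU]) /\
  (forall x0 mu,
     V0_ W T x0 mu = sqnorm Q0f (x0 - Gam0fpi *m zbar mu - eta0f d)).

Definition master (W : values) (k : 'I_K) : Prop :=
  (forall t z x0 mu, 0 <= t <= T ->
     [/\ diff2 (fun x => V_ W k t z x mu), diff2 (fun y => V_ W k t y x0 mu) &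
     exists dt, exists dU : 'I_K -> 'cV[R]_n -> R,
       let gx := grad (fun x => V_ W k t z x mu) x0 in
       let gz := grad (fun y => V_ W k t y x0 mu) z in
       [/\ is_deriv_on T (fun u => V_ W k u z x0 mu) t dt,
           forall l, is_flat_deriv (V_ W k t z x0) mu l (dU l),
           transport_wf W t x0 mu dU &
           - dt + rho * V_ W k t z x0 mu =
             sdot gx (A0 *m x0 + F0pi *m zbar mu)
             - 2^-1 * sdot gx
                 (B0 *m R0i *m B0^T *m grad (fun x => V0_ W t x mu) x0)
             + 2^-1 * \tr (hess (fun x => V_ W k t z x mu) x0
                             *m mD0 d *m (mD0 d)^T)
             + sdot gz (A k *m z + G *m x0 + Fpi *m zbar mu)
             - 4^-1 * sdot gz (B *m Ri *m B^T *m gz)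
             + sqnorm Q (z - Gam1 d *m x0 - Gam2pi *m zbar mu - eta d)
             + 2^-1 * \tr (hess (fun y => V_ W k t y x0 mu) z
                             *m mD d *m (mD d)^T)
             + transport W t x0 mu dU]]) /\
  (forall z x0 mu,
     V_ W k T z x0 mu =
       sqnorm Qf (z - Gam1f d *m x0 - Gam2fpi *m zbar mu - etaf d)).

Definition master_solution (W : values) : Prop :=
  master0 W /\ forall k, master W k.

Record coeffs := Coeffs {
  Pd0 : R -> 'M[R]_(n + nK) ;
  Pd : 'I_K -> R -> 'M[R]_(n + (n + nK)) ;
  sd0 : R -> 'cV[R]_(n + nK) ;
  sd : 'I_K -> R -> 'cV[R]_(n + (n + nK)) ;
  rd0 : R -> R ;
  rd : 'I_K -> R -> R }.

Definition coeffs_wf (C : coeffs) : Prop :=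
  [/\ forall t, 0 <= t <= T -> (Pd0 C t)^T = Pd0 C t,
      forall k t, 0 <= t <= T -> (Pd C k t)^T = Pd C k t,
      derivable_on T (Pd0 C) /\ (forall k, derivable_on T (Pd C k)),
      derivable_on T (sd0 C) /\ (forall k, derivable_on T (sd C k)) &
      derivable_on T (rd0 C) /\ (forall k, derivable_on T (rd C k))].

Definition has_quadratic_form (W : values) (C : coeffs) : Prop :=
  (forall t x0 mu, 0 <= t <= T ->
     let xi := col_mx x0 (zbar mu) in
     V0_ W t x0 mu = sqnorm (Pd0 C t) xi + 2 * sdot (sd0 C t) xi + rd0 C t) /\
  (forall k t z x0 mu, 0 <= t <= T ->
     let xi := col_mx z (col_mx x0 (zbar mu)) in
     V_ W k t z x0 mu =
       sqnorm (Pd C k t) xi + 2 * sdot (sd C k t) xi + rd C k t).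

Definition quadratic_solution (W : values) (C : coeffs) : Prop :=
  [/\ master_solution W, coeffs_wf C & has_quadratic_form W C].

Definition values_eq_on (W W' : values) : Prop :=
  forall t, 0 <= t <= T ->
    (forall x0 mu, V0_ W t x0 mu = V0_ W' t x0 mu) /\
    (forall k z x0 mu, V_ W k t z x0 mu = V_ W' k t z x0 mu).

Definition coeffs_match (X : nce) (C : coeffs) : Prop :=
  forall t, 0 <= t <= T ->
    [/\ P0_ X t = Pd0 C t, forall k, P_ X k t = Pd C k t,
        s0_ X t = sd0 C t & forall k, s_ X k t = sd C k t].

End Equations.

(* Main.v *)
Require Import Defs.
From mathcomp Require Import all_boot all_order all_algebra.
From mathcomp Require Import all_classical all_reals all_analysis.
From mathcomp Require Import measurable_realfun.
From mathcomp Require Import ring lra.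

(** Evaluated at a function that is quadratic in the states and in the vector
    [zbar mu] of population means, every term of a master equation is a
    quadratic polynomial in the same variables. The reason is that such a
    function has affine flat derivatives: a mixture of measures moves the means
    along a segment, so the flat derivative in the direction of the [l]-th class
    is, up to a constant, linear with slope the [l]-th block of the gradient in
    the means ([is_flat_deriv_slope], and conversely [flat_deriv_affine], by
    testing against point masses). The transport integrals are then integrals of
    affine functions, i.e. values at the means, and the average of the optimally
    controlled dynamics over a class is the mean field dynamics with
    coefficients [Abar], [Gbar], [mbar] given by the algebraic equations
    ([transport_consistent]).

    Hence each master equation is the dynamic programming identity of one
    linear-quadratic control problem in the joint state [xi], made of the
    players' states and the means ([master0_rhsE], [master_rhsE]). Point masses
    realize every vector of means, so the identity holds for all [xi], and
    comparing coefficients of polynomials ([hjb_riccati]) gives exactly the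
    Riccati equation for [P], the linear equation for [s], and a scalar linear
    equation for the constant term [r]. Read forwards this yields the
    equilibrium from a quadratic solution ([quadratic_to_nce]). Read backwards
    it yields the quadratic solution from an equilibrium ([nce_to_quadratic]),
    given that [r] exists by variation of constants ([linear_ode_exists]) and
    that the matrices [P] are symmetric.

    Symmetry and uniqueness have the same source. The vector fields are
    polynomial, hence Lipschitz along two bounded solutions, and two solutions
    with the same terminal value coincide by a backward Gronwall inequality
    ([close_ode_unique]). Compared with the transposed family this gives
    symmetry ([nce_sym]); compared with a second solution it gives uniqueness,
    first of the Riccati system and then of the linear one ([nce_unique]). The
    value functions inherit uniqueness through the correspondence. *)

Set Implicit Arguments.
Unset Strict Implicit.
Unset Printing Implicit Defensive.

Import Order.TTheory GRing.Theory Num.Theory.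
Import numFieldNormedType.Exports.
Local Open Scope classical_set_scope.
Local Open Scope ring_scope.

(** * Inner products and quadratic polynomials *)

Section InnerProduct.
Context {R : realType}.
Implicit Types (p q : nat).

Lemma sdotC p (u v : 'cV[R]_p) : sdot u v = sdot v u.
Proof.
by rewrite /sdot !mxE; apply: eq_bigr => i _; rewrite !mxE mulrC.
Qed.

Lemma sdotDl p (u v w : 'cV[R]_p) : sdot (u + v) w = sdot u w + sdot v w.
Proof. by rewrite /sdot linearD mulmxDl mxE. Qed.

Lemma sdotDr p (u v w : 'cV[R]_p) : sdot w (u + v) = sdot w u + sdot w v.
Proof. by rewrite /sdot mulmxDr mxE. Qed.

Lemma sdotZl p a (u v : 'cV[R]_p) : sdot (a *: u) v = a * sdot u v.
Proof. by rewrite /sdot linearZ -scalemxAl mxE. Qed.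

Lemma sdotZr p a (u v : 'cV[R]_p) : sdot u (a *: v) = a * sdot u v.
Proof. by rewrite /sdot -scalemxAr mxE. Qed.

Lemma sdotNl p (u v : 'cV[R]_p) : sdot (- u) v = - sdot u v.
Proof. by rewrite -scaleN1r sdotZl mulN1r. Qed.

Lemma sdotNr p (u v : 'cV[R]_p) : sdot u (- v) = - sdot u v.
Proof. by rewrite -scaleN1r sdotZr mulN1r. Qed.

Lemma sdot0l p (u : 'cV[R]_p) : sdot 0 u = 0.
Proof. by rewrite /sdot trmx0 mul0mx mxE. Qed.

Lemma sdot0r p (u : 'cV[R]_p) : sdot u 0 = 0.
Proof. by rewrite /sdot mulmx0 mxE. Qed.

Lemma sdot_mulmx p q (M : 'M[R]_(p, q)) u v :
  sdot (M *m u) v = sdot u (M^T *m v).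
Proof. by rewrite /sdot trmx_mul mulmxA. Qed.

Lemma sdot_col p q (a c : 'cV[R]_p) (b e : 'cV[R]_q) :
  sdot (col_mx a b) (col_mx c e) = sdot a c + sdot b e.
Proof. by rewrite /sdot tr_col_mx mul_row_col mxE. Qed.

Lemma sdotE p (u v : 'cV[R]_p) : sdot u v = \sum_i u i 0 * v i 0.
Proof. by rewrite /sdot mxE; apply: eq_bigr => i _; rewrite mxE. Qed.

Lemma sdot_stack p m (u v : 'cV[R]_(\sum_(k < m) p)%N) :
  sdot u v = \sum_(k < m) sdot (blockrow u k) (blockrow v k).
Proof.
rewrite -{1}(submxcolK u) -{1}(submxcolK v) /sdot tr_mxcol.
by rewrite mul_mxrow_mxcol summxE.
Qed.

Lemma sdot_delta p (u : 'cV[R]_p) i : sdot u (delta_mx i 0) = u i 0.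
Proof.
rewrite sdotE (bigD1 i)//= big1 ?mxE ?eqxx ?mulr1 ?addr0// => j ji.
by rewrite mxE (negbTE ji) mulr0.
Qed.

Lemma sdot_sym p (M : 'M[R]_p) u v : M^T = M -> sdot (M *m u) v = sdot u (M *m v).
Proof. by move=> sM; rewrite sdot_mulmx sM. Qed.

End InnerProduct.

Section QuadraticPolynomials.
Context {R : realType}.

Definition quad p (P : 'M[R]_p) (s : 'cV[R]_p) (r : R) (xi : 'cV[R]_p) : R :=
  sqnorm P xi + 2 * sdot s xi + r.

(** Restricting a quadratic polynomial to an affine subspace keeps it quadratic;
    this is how partial gradients in one block of variables are reduced to full
    gradients. *)
Lemma quad_affine p q (P : 'M[R]_p) s r (E : 'M[R]_(p, q)) c x : P^T = P ->
  quad P s r (E *m x + c) =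
  quad (E^T *m P *m E) (E^T *m (P *m c + s)) (quad P s r c) x.
Proof.
move=> sP; rewrite /quad /sqnorm !(mulmxDr, sdotDl, sdotDr) -!mulmxA.
rewrite -!(sdot_mulmx E) -[sdot (E^T *m _) x]sdotC -(sdot_mulmx E).
rewrite [sdot (E^T *m s) x]sdotC -(sdot_mulmx E).
rewrite [sdot c (P *m (E *m x))]sdotC (sdot_sym _ _ sP).
rewrite [sdot s (E *m x)]sdotC.
ring.
Qed.

(** Comparing the values at [xi] and [- xi] separates the linear from the
    quadratic part; the former is then read off on basis vectors, the latter by
    polarization. *)
Lemma quad_eq0 p (P : 'M[R]_p) s r : P^T = P ->
  (forall xi, quad P s r xi = 0) -> [/\ P = 0, s = 0 & r = 0].
Proof.
move=> sP q0.
have r0 : r = 0.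
  by have := q0 0; rewrite /quad /sqnorm mulmx0 !sdot0r mulr0 !add0r.
have h xi : sqnorm P xi = 0 /\ sdot s xi = 0.
  have := q0 xi; have := q0 (- xi).
  rewrite /quad /sqnorm mulmxN !sdotNl !sdotNr opprK r0; lra.
have s0 : s = 0.
  by apply/colP => i; have [_] := h (delta_mx i 0); rewrite sdot_delta mxE.
suff P0 : P = 0 by [].
apply/matrixP => i j; rewrite [RHS]mxE.
have := (h (delta_mx i 0 + delta_mx j 0)).1.
have := (h (delta_mx i 0)).1; have := (h (delta_mx j 0)).1.
rewrite /sqnorm mulmxDr !(sdotDl, sdotDr) => -> ->.
rewrite -[sdot (delta_mx j 0) (_ *m delta_mx i 0)]sdotC (sdot_sym _ _ sP).
rewrite sdotC sdot_delta -colE mxE; lra.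
Qed.

Lemma quadB p (P P' : 'M[R]_p) s s' r r' xi :
  quad P s r xi - quad P' s' r' xi = quad (P - P') (s - s') (r - r') xi.
Proof.
by rewrite /quad /sqnorm mulmxBl !(sdotDl, sdotDr, sdotNl, sdotNr); ring.
Qed.

Lemma quad_inj p (P P' : 'M[R]_p) s s' r r' : P^T = P -> P'^T = P' ->
  (forall xi, quad P s r xi = quad P' s' r' xi) ->
  [/\ P = P', s = s' & r = r'].
Proof.
move=> sP sP' h.
have [|xi|P0 s0 r0] := @quad_eq0 _ (P - P') (s - s') (r - r').
- by rewrite linearB /= sP sP'.
- by rewrite -quadB h subrr.
- by split; apply/eqP; rewrite -subr_eq0 ?P0 ?s0 ?r0.
Qed.

Lemma sqnorm_affine p q (Q : 'M[R]_p) (H : 'M[R]_(p, q)) e xi : Q^T = Q ->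
  sqnorm Q (H *m xi - e) =
  quad (H^T *m Q *m H) (- (H^T *m Q *m e)) (sqnorm Q e) xi.
Proof.
move=> sQ; have := quad_affine 0 0 H (- e) xi sQ.
rewrite {1}/quad sdot0l mulr0 !addr0 => ->.
by rewrite /quad /sqnorm sdot0l mulr0 !addr0 mulmxN sdotNl sdotNr opprK mulmxN mulmxA.
Qed.

(** The gradient of a quadratic value function is the affine costate
    [2 (P xi + s)]; inserted into the minimized Hamiltonian of the dynamics
    [a xi + m] with running cost [sqnorm Q (H xi - e) + c], it produces the
    right-hand sides of the Riccati equation and of its affine companions. Here
    [S] stands for [B R^-1 B^T], which the optimal control brings in. *)
Lemma hamiltonian_quad p q (P a S : 'M[R]_p) (s m : 'cV[R]_p)
    (Q : 'M[R]_q) (H : 'M[R]_(q, p)) e c xi :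
    P^T = P -> S^T = S -> Q^T = Q ->
  2 * sdot (P *m xi + s) (a *m xi + m)
  - sdot (P *m xi + s) (S *m (P *m xi + s))
  + sqnorm Q (H *m xi - e) + c =
  quad (P *m a + a^T *m P - P *m S *m P + H^T *m Q *m H)
       ((a^T - P *m S) *m s + P *m m - H^T *m Q *m e)
       (2 * sdot s m - sdot s (S *m s) + sqnorm Q e + c) xi.
Proof.
move=> sP sS sQ; rewrite sqnorm_affine// /quad.
set W := H^T *m Q *m H; set w := H^T *m Q *m e.
rewrite /sqnorm !(mulmxDl, mulmxDr, mulNmx, sdotDl, sdotDr, sdotNl, sdotNr).
rewrite -!mulmxA.
have e1 : sdot (P *m xi) (a *m xi) = sdot xi (P *m (a *m xi)).
  by rewrite sdot_sym.
have e2 : sdot xi (a^T *m (P *m xi)) = sdot xi (P *m (a *m xi)).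
  by rewrite -sdot_mulmx sdotC sdot_sym.
have e3 : sdot (P *m xi) m = sdot (P *m m) xi by rewrite sdot_sym// sdotC.
have e4 : sdot s (a *m xi) = sdot (a^T *m s) xi by rewrite sdotC sdot_mulmx sdotC.
have e5 : sdot (P *m xi) (S *m (P *m xi)) = sdot xi (P *m (S *m (P *m xi))).
  by rewrite sdot_sym.
have e6 : sdot (P *m xi) (S *m s) = sdot (P *m (S *m s)) xi.
  by rewrite sdot_sym// sdotC.
have e7 : sdot s (S *m (P *m xi)) = sdot (P *m (S *m s)) xi.
  by rewrite sdotC sdot_sym// -e6.
rewrite e1 e2 e3 e4 e5 e6 e7; ring.
Qed.

End QuadraticPolynomials.

(** * Derivatives in time and in space *)

Section DerivativeOnInterval.
Context {R : realType}.
Implicit Types (T t : R).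

(** The difference quotients at an endpoint of the interval still have a unique
    limit, because admissible increments of one sign remain. *)
Lemma deriv_on_filter_proper T t : 0 < T -> 0 <= t <= T ->
  ProperFilter (within [set h : R | 0 <= t + h <= T] 0^').
Proof.
move=> T0 /andP[t0 tT]; apply: Build_ProperFilter_ex => A /nbhs_ballP[e /= e0 eA].
suff [h [he h0 hT]] : exists h : R, [/\ `|h| < e, h != 0 & 0 <= t + h <= T].
  by exists h; apply: eA => //=; rewrite /ball /= sub0r normrN.
have [tT'|tT'] := ltP t T.
  exists (Num.min (e / 2) (T - t)).
  have m0 : 0 < Num.min (e / 2) (T - t) by rewrite lt_min subr_gt0 tT' divr_gt0.
  rewrite gtr0_norm// gt_eqF//; split => //.
    by rewrite gt_min ltr_pdivrMr// ltr_pMr// ltr1n.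
  have : Num.min (e / 2) (T - t) <= T - t by rewrite ge_min lexx orbT.
  move: m0; lra.
exists (- Num.min (e / 2) T).
have m0 : 0 < Num.min (e / 2) T by rewrite lt_min T0 divr_gt0.
rewrite normrN gtr0_norm// oppr_eq0 gt_eqF//; split => //.
  by rewrite gt_min ltr_pdivrMr// ltr_pMr// ltr1n.
have : Num.min (e / 2) T <= T by rewrite ge_min lexx orbT.
move: m0; lra.
Qed.

Lemma is_deriv_on_unique (W : normedModType R) T (f : R -> W) t df df' :
  0 < T -> 0 <= t <= T ->
  is_deriv_on T f t df -> is_deriv_on T f t df' -> df = df'.
Proof.
move=> T0 tT; have ? := deriv_on_filter_proper T0 tT.
exact: (@cvg_unique _ (@norm_hausdorff _ _)).
Qed.

Lemma is_deriv_on_ext (W : normedModType R) T (f g : R -> W) t df :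
  0 <= t <= T -> (forall u, 0 <= u <= T -> f u = g u) ->
  is_deriv_on T f t df -> is_deriv_on T g t df.
Proof.
move=> tT fg; apply: cvg_trans; apply: near_eq_cvg.
by apply: filterS (withinT _ _) => h /= hT; rewrite !fg.
Qed.

Lemma is_deriv_on_cst (W : normedModType R) T (c : W) t :
  is_deriv_on T (fun=> c) t 0.
Proof.
rewrite /is_deriv_on; under eq_fun do rewrite subrr scaler0.
exact: cvg_cst.
Qed.

Lemma is_deriv_onD (W : normedModType R) T (f g : R -> W) t df dg :
  is_deriv_on T f t df -> is_deriv_on T g t dg ->
  is_deriv_on T (fun u => f u + g u) t (df + dg).
Proof.
rewrite /is_deriv_on => hf hg.
rewrite [X in X @ _](_ : _ = (fun h : R => h^-1 *: (f (t + h) - f t)) +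
  (fun h => h^-1 *: (g (t + h) - g t))); first exact: cvgD.
by apply/funext => h /=; rewrite [RHS]/= opprD addrACA scalerDr.
Qed.

Lemma is_deriv_onZ T (a : R) (f : R -> R) t df :
  is_deriv_on T f t df -> is_deriv_on T (fun u => a * f u) t (a * df).
Proof.
rewrite /is_deriv_on => hf.
rewrite [X in X @ _](_ : _ = (fun h => a * (h^-1 *: (f (t + h) - f t)))).
  exact: cvgMl_tmp.
by apply/funext => h; rewrite -mulrBr /GRing.scale /= mulrCA.
Qed.

Lemma is_deriv_onB T (f g : R -> R) t df dg :
  is_deriv_on T f t df -> is_deriv_on T g t dg ->
  is_deriv_on T (fun u => f u - g u) t (df - dg).
Proof.
move=> hf /(is_deriv_onZ (a := -1)) hg; have := is_deriv_onD hf hg.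
by under [X in is_deriv_on _ X]eq_fun do rewrite mulN1r; rewrite mulN1r.
Qed.

Lemma is_deriv_onM T (f g : R -> R) t df dg :
  is_deriv_on T f t df -> is_deriv_on T g t dg ->
  is_deriv_on T (fun u => f u * g u) t (df * g t + f t * dg).
Proof.
rewrite /is_deriv_on => hf hg.
set F := within _ _ in hf hg *.
set qf := fun h : R => h^-1 *: (f (t + h) - f t) in hf.
set qg := fun h : R => h^-1 *: (g (t + h) - g t) in hg.
have id0 : (fun h : R => h) @ F --> (0 : R).
  by do 2 apply: cvg_within_filter; exact: cvg_id.
(* The second-order remainder of the Leibniz rule is [h] times a convergent
   quantity. *)
have L : (fun h => qf h * g t + f t * qg h + h * (qf h * qg h)) @ F -->
    df * g t + f t * dg.
  rewrite -[X in _ --> X]addr0; apply: cvgD.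
    by apply: cvgD; apply: cvgM => //; exact: cvg_cst.
  by rewrite -(mul0r (df * dg)); apply: cvgM => //; exact: cvgM.
apply: cvg_trans L; apply: near_eq_cvg.
have h0 : \forall h \near F, h != 0.
  rewrite /F near_withinE; near=> h => _; near: h; exact: nbhs_dnbhs_neq.
apply: filterS h0 => h h0; rewrite /qf /qg /GRing.scale /=; field.
exact: h0.
Unshelve. all: by end_near. Qed.

Lemma is_deriv_on_sum T (I : finType) (f : I -> R -> R) t df :
  (forall i, is_deriv_on T (f i) t (df i)) ->
  is_deriv_on T (fun u => \sum_i f i u) t (\sum_i df i).
Proof.
move=> h; rewrite unlock; elim: (index_enum I) => [|i s IHs] /=.
  exact: is_deriv_on_cst.
exact: is_deriv_onD.
Qed.

Lemma is_deriv_on_entry T p q (M : R -> 'M[R]_(p, q)) t dM i j :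
  is_deriv_on T M t dM -> is_deriv_on T (fun u => M u i j) t (dM i j).
Proof.
rewrite /is_deriv_on => h.
rewrite [X in X @ _](_ : _ = (fun N : 'M[R]_(p, q) => N i j) \o
  (fun h => h^-1 *: (M (t + h) - M t))).
  exact: cvg_comp h (@coord_continuous R p q i j dM).
by apply/funext => e /=; rewrite !mxE.
Qed.

(** The increment is [h] times the difference quotient, hence tends to zero. *)
Lemma is_deriv_on_continuous_at (W : normedModType R) T (f : R -> W) t df :
  0 <= t <= T -> is_deriv_on T f t df ->
  f @ within `[0, T] (nbhs t) --> f t.
Proof.
move=> tT hf.
have h0 : (fun h : R => h *: (h^-1 *: (f (t + h) - f t))) @
    within [set h | 0 <= t + h <= T] 0^' --> (0 : W).
  rewrite -(scale0r df); apply: cvgZ hf.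
  by apply: cvg_within_filter; apply: cvg_trans; [exact: cvg_within|exact: cvg_id].
move=> A /= /nbhs_ballP[e /= e0 eA].
have /(_ _ (nbhsx_ballx (0 : W) e e0)) := h0.
rewrite /= !nbhs_simpl /= => /nbhs_ballP[r /= r0 rP].
apply/nbhs_ballP; exists r => //= u tu uT.
apply: eA; have [->|ut] := eqVneq u t; first exact: ballxx.
have ut0 : u - t != 0 by rewrite subr_eq0.
have /= := rP (u - t).
rewrite [t + _]addrC subrK scalerA divff// scale1r -!ball_normE /= !sub0r !normrN.
rewrite (distrC (f t)); apply => //.
by move: tu; rewrite -ball_normE /= distrC.
Qed.

Lemma is_deriv_on_continuous (W : normedModType R) T (f : R -> W) :
  (forall t, 0 <= t <= T -> exists df, is_deriv_on T f t df) ->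
  {within `[0, T], continuous f}.
Proof.
move=> hf; apply/subspace_continuousP => t /=; rewrite in_itv /= => tT.
by have [df] := hf t tT; exact: is_deriv_on_continuous_at.
Qed.

Lemma is_deriv_on_interior T (f : R -> R) t df :
  0 < t < T -> is_deriv_on T f t df -> is_derive t 1 f df.
Proof.
move=> /andP[t0 tT] hf.
have hf' : h^-1 *: (f (h *: 1 + t) - f t) @[h --> 0^'] --> df.
  have := hf; apply: cvg_trans => A /= /nbhs_ballP[e /= e0 eA].
  have m0 : 0 < Num.min e (Num.min t (T - t)) by rewrite !lt_min e0 t0 subr_gt0.
  apply/nbhs_ballP; exists (Num.min e (Num.min t (T - t))) => //= h.
  rewrite /ball /= sub0r normrN !lt_min => /and3P[he ht hT] h0.
  have /= := eA h; rewrite [h%:A]mulr1 [h + t]addrC; apply => //.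
    by rewrite /ball /= sub0r normrN.
  by move: ht hT; rewrite !ltr_norml; lra.
apply: DeriveDef; first by apply/cvg_ex; exists df.
by apply/cvg_lim => //.
Qed.

Lemma is_derive_is_deriv_on T (f : R -> R) t df :
  is_derive t 1 f df -> is_deriv_on T f t df.
Proof.
move=> [/cvg_ex[l hl] dE]; have : df = l by rewrite -dE; apply/cvg_lim.
move=> ->; apply: cvg_within_filter.
rewrite [X in X @ _](_ : _ = (fun h : R => h^-1 *: (f (h *: 1 + t) - f t))).
  exact: hl.
by apply/funext => h /=; rewrite [h%:A]mulr1 [h + t]addrC.
Qed.

End DerivativeOnInterval.

Section QuadraticCalculus.
Context {R : realType}.

Lemma differentiable_sdot p (c x : 'cV[R]_p) : differentiable (sdot c) x.
Proof.
have -> : sdot c = \sum_(i < p) (fun y : 'cV[R]_p => c i 0 * y i 0).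
  by apply/funext => y; rewrite fct_sumE sdotE.
apply: differentiable_sum => i.
by apply: differentiableM; [exact: differentiable_cst|exact: differentiable_coord].
Qed.

Lemma differentiable_quad p (P : 'M[R]_p) s r x : differentiable (quad P s r) x.
Proof.
have -> : quad P s r = (fun y => sqnorm P y) + (fun y => sdot (2 *: s) y) + cst r.
  by apply/funext => y; rewrite /quad -sdotZl.
apply: differentiableD; last exact: differentiable_cst.
apply: differentiableD; last exact: differentiable_sdot.
have -> : (fun y => sqnorm P y) =
    \sum_(i < p) ((fun y : 'cV[R]_p => y i 0) * sdot (row i P)^T).
  apply/funext => y; rewrite fct_sumE /sqnorm sdotE; apply: eq_bigr => i _.
  transitivity (y i 0 * sdot (row i P)^T y); last by [].
  by rewrite /sdot trmxK -row_mul [in RHS]mxE.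
apply: differentiable_sum => i.
by apply: differentiableM; [exact: differentiable_coord|exact: differentiable_sdot].
Qed.

Lemma derive_quad p (P : 'M[R]_p) s r x v : P^T = P ->
  'D_v (quad P s r) x = 2 * sdot (P *m x + s) v.
Proof.
move=> sP; apply/cvg_lim => //.
have L : (fun h : R => 2 * sdot (P *m x + s) v + h * sqnorm P v) @ 0^' -->
    2 * sdot (P *m x + s) v.
  rewrite -[X in _ --> X]addr0; apply: cvgD; first exact: cvg_cst.
  rewrite -[X in _ --> X](mul0r (sqnorm P v)); apply: cvgM; last exact: cvg_cst.
  by apply: cvg_within_filter; exact: cvg_id.
apply: cvg_trans L; apply: near_eq_cvg; near=> h => /=.
have h0 : h != 0 by near: h; exact: nbhs_dnbhs_neq.
rewrite /quad /sqnorm !(mulmxDr, sdotDl, sdotDr) -!scalemxAr.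
rewrite !(sdotZl, sdotZr) (sdot_sym _ _ sP) [sdot v (P *m x)]sdotC (sdot_sym _ _ sP).
rewrite /GRing.scale /=; field.
Unshelve. all: by end_near. Qed.

Lemma grad_quad p (P : 'M[R]_p) s r x : P^T = P ->
  grad (quad P s r) x = 2 *: (P *m x + s).
Proof.
by move=> sP; apply/colP => i; rewrite !mxE derive_quad// sdot_delta !mxE.
Qed.

Lemma hess_quad p (P : 'M[R]_p) s r x : P^T = P ->
  hess (quad P s r) x = 2 *: P.
Proof.
move=> sP; apply/matrixP => i j; rewrite [LHS]mxE.
have -> : (fun u => grad (quad P s r) u j 0) =
    quad 0 (col j P) (2 * s j 0).
  apply/funext => u; rewrite grad_quad// /quad /sqnorm mul0mx sdot0r add0r.
  by rewrite mxE [X in 2 * X]mxE mulrDr /sdot tr_col sP -row_mul [in RHS]mxE.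
by rewrite derive_quad ?trmx0// mul0mx add0r sdot_delta !mxE.
Qed.

Lemma differentiable_mulmx p q (M : 'M[R]_(p, q)) x :
  differentiable (fun y : 'cV[R]_q => M *m y) x.
Proof.
have -> : (fun y : 'cV[R]_q => M *m y) =
    \sum_(j < q) (fun y : 'cV[R]_q => y j 0 *: col j M).
  apply/funext => y; rewrite fct_sumE; apply/colP => i.
  by rewrite mxE summxE; apply: eq_bigr => j _; rewrite !mxE mulrC.
by apply: differentiable_sum => j; apply/differentiableZl/differentiable_coord.
Qed.

Lemma diff2_quad p (P : 'M[R]_p) s r : P^T = P -> diff2 (quad P s r).
Proof.
move=> sP; split=> x; first exact: differentiable_quad.
have -> : grad (quad P s r) = (fun y => (2 *: P) *m y) + cst (2 *: s).
  by apply/funext => y; rewrite grad_quad//= scalerDr scalemxAl.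
by apply: differentiableD; [exact: differentiable_mulmx|exact: differentiable_cst].
Qed.

End QuadraticCalculus.

(** * Scalar linear equations *)

Section LinearScalarODE.
Context {R : realType}.

(** Clamping the argument to the interval turns one-sided continuity at the
    endpoints into continuity on the line. *)
Lemma continuous_clamp (T : R) (g : R -> R) : 0 <= T ->
  {within `[0, T], continuous g} ->
  continuous (fun t => g (Num.max 0 (Num.min t T))).
Proof.
move=> T0 /subspace_continuousP cg t.
have clampT u : 0 <= Num.max 0 (Num.min u T) <= T.
  by rewrite le_max lexx/= ge_max T0 ge_min lexx orbT.
apply: (cvg_comp (fun t => Num.max 0 (Num.min t T)) g); last first.
  by apply: cg => /=; rewrite in_itv /= clampT.
have cc : Num.max 0 (Num.min u T) @[u --> t] --> Num.max 0 (Num.min t T).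
  apply: (@continuous_max _ _ (fun=> 0) (fun u => Num.min u T) t).
    by apply: cvg_cst; exact: nbhs_filter.
  apply: (@continuous_min _ _ id (fun=> T) t).
    by apply: cvg_id.
  by apply: cvg_cst; exact: nbhs_filter.
move=> A hA; apply: (@filterS _ (nbhs t) _ _ _ _ (cc _ hA)) => u; apply.
by rewrite /= in_itv /= clampT.
Qed.

(** Variation of constants, with the source extended constantly outside the
    interval so that the fundamental theorem of calculus also gives the
    derivative at the endpoints. *)
Lemma linear_ode_exists (T rho c : R) (g : R -> R) : 0 < T ->
  {within `[0, T], continuous g} ->
  exists r : R -> R, r T = c /\
    forall t, 0 <= t <= T -> is_deriv_on T r t (rho * r t - g t).
Proof.
move=> T0 cg.
pose h u := expR (- rho * u) * g (Num.max 0 (Num.min u T)).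
have ch : continuous h.
  move=> u; apply: cvgM; last exact: continuous_clamp (ltW T0) cg u.
  apply: (cvg_comp (fun u : R => - rho * u) expR); last exact: continuous_expR.
  exact: mulrl_continuous.
(* The lower bound lies strictly below 0, so that 0 is an interior point. *)
pose F x := \int[@lebesgue_measure R]_(u in `[-1, x]) h u.
have dF t : 0 <= t <= T -> is_derive t 1 F (h t).
  move=> /andP[t0 tT].
  have hi : (@lebesgue_measure R).-integrable `[-1, T + 1] (EFin \o h).
    apply: continuous_compact_integrable; first exact: segment_compact.
    exact: continuous_subspaceT.
  have [||dF FE] := continuous_FTC1_closed (x := t) _ hi _ (ch t).
  - by rewrite (le_lt_trans tT)// ltrDl.
  - by rewrite (lt_le_trans _ t0)// ltrN10.
  by apply: DeriveDef => //; rewrite -derive1E.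
pose a := expR (- rho * T) * c + F T.
exists (fun t => expR (rho * t) * (a - F t)); split.
  by rewrite /a addrK mulrA -expRD mulNr subrr expR0 mul1r.
move=> t tT; apply: is_derive_is_deriv_on.
have dFt := dF t tT.
have ht : expR (rho * t) * h t = g t.
  move/andP: tT => [t0 tT]; rewrite /h mulrA -expRD mulNr subrr expR0 mul1r.
  by rewrite min_l// max_r.
apply: is_derive_eq; rewrite -ht /GRing.scale /=; ring.
Qed.

End LinearScalarODE.

(** * Uniqueness for terminal value problems *)

Section Gronwall.
Context {R : realType}.
Implicit Types (T t : R).

(** The sum of squares [phi] satisfies [phi' >= - c phi], so [expR (c t) phi]
    is nondecreasing and vanishes at the terminal time. *)
Lemma backward_gronwall T (I : finType) (z dz : I -> R -> R) (C : R) : 0 <= C ->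
  (forall i t, 0 <= t <= T -> is_deriv_on T (z i) t (dz i t)) ->
  (forall i t, 0 <= t <= T -> `|dz i t| <= C * \sum_j `|z j t|) ->
  (forall i, z i T = 0) ->
  forall i t, 0 <= t <= T -> z i t = 0.
Proof.
move=> C0 hd hb hT.
pose phi t := \sum_i z i t * z i t.
pose dphi t := \sum_i (dz i t * z i t + z i t * dz i t).
have dphiP t : 0 <= t <= T -> is_deriv_on T phi t (dphi t).
  by move=> tT; apply: is_deriv_on_sum => i; apply: is_deriv_onM; exact: hd.
(* From [2 `|z i| `|z j| <= z i ^+ 2 + z j ^+ 2], summed over both indices. *)
pose c : R := 2 * C * #|I|%:R.
have phi_ge t : 0 <= t <= T -> 0 <= c * phi t + dphi t.
  move=> tT.
  have -> : c * phi t + dphi t = \sum_i (\sum_j C * (z i t ^+ 2 + z j t ^+ 2)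
      + (dz i t * z i t + z i t * dz i t)).
    rewrite big_split /=; congr (_ + _).
    under eq_bigr do rewrite -mulr_sumr big_split /= sumr_const.
    rewrite -mulr_sumr big_split /= sumr_const sumrMnl /c /phi.
    under [in LHS]eq_bigr do rewrite -expr2.
    rewrite -[_ *+ #|_|]mulr_natr; ring.
  apply: sumr_ge0 => i _.
  have h1 : `|z i t * dz i t| <= \sum_j C * (`|z i t| * `|z j t|).
    rewrite normrM; apply: le_trans (ler_wpM2l (normr_ge0 _) (hb i t tT)) _.
    by rewrite mulrCA !mulr_sumr.
  have h2 : \sum_j C * (`|z i t| * `|z j t|) *+ 2 <=
      \sum_j C * (z i t ^+ 2 + z j t ^+ 2).
    apply: ler_sum => j _; rewrite -mulrnAr ler_wpM2l//.
    rewrite -(real_normK (num_real (z i t))) -(real_normK (num_real (z j t))).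
    have := sqr_ge0 (`|z i t| - `|z j t|); rewrite mulr2n; nra.
  have := ler_norm (- (z i t * dz i t)); rewrite normrN => h3.
  rewrite sumrMnl mulr2n in h2; move: h1 h2 h3; rewrite [dz i t * _]mulrC; lra.
pose w t := expR (c * t) * phi t.
have cphi : {within `[0, T], continuous phi}.
  by apply: is_deriv_on_continuous => t tT; exists (dphi t); exact: dphiP.
have cw : {within `[0, T], continuous w}.
  apply/subspace_continuousP => t tT; apply: cvgM.
    apply: cvg_within_filter.
    apply: (cvg_comp (fun u : R => c * u) expR); last exact: continuous_expR.
    exact: mulrl_continuous.
  by move/subspace_continuousP: cphi; exact.
have dw t : 0 < t < T -> is_derive t 1 w (expR (c * t) * (c * phi t + dphi t)).
  move=> tT; have tT' : 0 <= t <= T by move/andP: tT => [? ?]; rewrite !ltW.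
  have := is_deriv_on_interior tT (dphiP t tT') => dphit.
  by apply: is_derive_eq; rewrite /GRing.scale /=; ring.
move=> i t tT; have := tT => /andP[t0 tT'].
have : w t <= w T.
  apply: (@ger0_derive1_ndecr _ w 0 T _ _ cw t T t0 tT' (lexx T)) => u;
    rewrite in_itv /= => uT.
    by have := dw u uT => dwu; exact: ex_derive.
  have dwu := dw u uT; rewrite derive1E derive_val mulr_ge0 ?expR_ge0//.
  by apply: phi_ge; move/andP: uT => [? ?]; rewrite !ltW.
rewrite /w [X in _ <= _ * X]big1 => [|j _]; last by rewrite hT mulr0.
rewrite mulr0 pmulr_rle0 ?expR_gt0// => phi0.
have phi_ge0 j : 0 <= z j t * z j t by rewrite -expr2 sqr_ge0.
have : \sum_j z j t * z j t = 0.
  by apply/eqP; rewrite eq_le phi0 sumr_ge0.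
move=> /psumr_eq0P h; apply/eqP; rewrite -[_ == 0]orbb -mulf_eq0; apply/eqP.
by apply: h.
Qed.

Lemma linear_ode_unique T (rho : R) (g r r' : R -> R) : 0 <= rho ->
  (forall t, 0 <= t <= T -> is_deriv_on T r t (rho * r t - g t)) ->
  (forall t, 0 <= t <= T -> is_deriv_on T r' t (rho * r' t - g t)) ->
  r T = r' T -> forall t, 0 <= t <= T -> r t = r' t.
Proof.
move=> rho0 hr hr' rT t tT; apply/eqP; rewrite -subr_eq0; apply/eqP.
apply: (@backward_gronwall T unit (fun _ u => r u - r' u)
  (fun _ u => rho * (r u - r' u)) rho rho0 _ _ _ tt t tT).
- move=> _ u uT.
  have -> : rho * (r u - r' u) = (rho * r u - g u) - (rho * r' u - g u) by ring.
  by apply: is_deriv_onB; [exact: hr|exact: hr'].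
- by move=> _ u _; rewrite big_const card_unit /= addr0 normrM (ger0_norm rho0).
- by move=> _; rewrite rT subrr.
Qed.

Lemma bounded_on_segment T (f : R -> R) : {within `[0, T], continuous f} ->
  exists2 C, 0 <= C & forall t, 0 <= t <= T -> `|f t| <= C.
Proof.
move=> /continuous_compact /(_ (@segment_compact _ 0 T)) /compact_bounded.
move=> [M [_ hM]]; exists (`|M| + 1); first by rewrite addr_ge0.
move=> t tT; apply: (hM (`|M| + 1)).
  by rewrite (le_lt_trans (ler_norm M))// ltrDl.
by exists t => //=; rewrite in_itv.
Qed.

(** A relation on scalar functions that is a congruence for the ring
    operations extends entrywise to matrix functions and is then preserved by
    all polynomial matrix expressions. The two instances below are continuity
    and Lipschitz closeness. *)
Record ring_congruence (rel : (R -> R) -> (R -> R) -> Prop) : Prop := {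
  congr_cst : forall c : R, rel (fun=> c) (fun=> c) ;
  congrN : forall f g, rel f g -> rel (fun t => - f t) (fun t => - g t) ;
  congrD : forall f g f' g', rel f g -> rel f' g' ->
    rel (fun t => f t + f' t) (fun t => g t + g' t) ;
  congrM : forall f g f' g', rel f g -> rel f' g' ->
    rel (fun t => f t * f' t) (fun t => g t * g' t) }.

Definition rel_mx (rel : (R -> R) -> (R -> R) -> Prop) p q
    (E F : R -> 'M[R]_(p, q)) : Prop :=
  forall i j, rel (fun t => E t i j) (fun t => F t i j).

Section MatrixCongruence.
Variable rel : (R -> R) -> (R -> R) -> Prop.
Hypothesis rel_congr : ring_congruence rel.
Local Notation mrel := (rel_mx rel).

Lemma congr_sum (I : finType) (f g : I -> R -> R) :
  (forall i, rel (f i) (g i)) ->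
  rel (fun t => \sum_i f i t) (fun t => \sum_i g i t).
Proof.
move=> h; rewrite unlock; elim: (index_enum I) => [|i s IHs] /=.
  exact: congr_cst.
exact: congrD.
Qed.

(** With the entries of both sides in closed form, a rule for matrices reduces to
    the scalar rules. *)
Lemma rel_mx_entries p q (E F : R -> 'M[R]_(p, q)) (e f : 'I_p -> 'I_q -> R -> R) :
  (forall t i j, E t i j = e i j t) -> (forall t i j, F t i j = f i j t) ->
  (forall i j, rel (e i j) (f i j)) -> mrel E F.
Proof.
move=> hE hF h i j.
have -> : (fun t => E t i j) = e i j by apply/funext.
by have -> : (fun t => F t i j) = f i j by apply/funext.
Qed.

Lemma rel_mx_cst p q (c : 'M[R]_(p, q)) : mrel (fun=> c) (fun=> c).
Proof. by move=> i j; exact: congr_cst. Qed.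

Lemma rel_mxN p q (E F : R -> 'M[R]_(p, q)) : mrel E F ->
  mrel (fun t => - E t) (fun t => - F t).
Proof.
move=> h; apply: rel_mx_entries => [t i j|t i j|i j]; [exact: mxE|exact: mxE|].
exact: congrN.
Qed.

Lemma rel_mxD p q (E F E' F' : R -> 'M[R]_(p, q)) : mrel E F -> mrel E' F' ->
  mrel (fun t => E t + E' t) (fun t => F t + F' t).
Proof.
move=> h h'; apply: rel_mx_entries => [t i j|t i j|i j]; [exact: mxE|exact: mxE|].
exact: congrD.
Qed.

Lemma rel_mxB p q (E F E' F' : R -> 'M[R]_(p, q)) : mrel E F -> mrel E' F' ->
  mrel (fun t => E t - E' t) (fun t => F t - F' t).
Proof. by move=> h h'; apply: rel_mxD => //; exact: rel_mxN. Qed.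

Lemma rel_mxZ p q c (E F : R -> 'M[R]_(p, q)) : mrel E F ->
  mrel (fun t => c *: E t) (fun t => c *: F t).
Proof.
move=> h; apply: rel_mx_entries => [t i j|t i j|i j]; [exact: mxE|exact: mxE|].
by apply: congrM => //; exact: congr_cst.
Qed.

Lemma rel_mxM p q r (E F : R -> 'M[R]_(p, q)) (E' F' : R -> 'M[R]_(q, r)) :
  mrel E F -> mrel E' F' ->
  mrel (fun t => E t *m E' t) (fun t => F t *m F' t).
Proof.
move=> h h'; apply: rel_mx_entries => [t i j|t i j|i j]; [exact: mxE|exact: mxE|].
by apply: congr_sum => k; exact: congrM.
Qed.

Lemma rel_mx_tr p q (E F : R -> 'M[R]_(p, q)) : mrel E F ->
  mrel (fun t => (E t)^T) (fun t => (F t)^T).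
Proof.
by move=> h; apply: rel_mx_entries => [t i j|t i j|i j]; [exact: mxE|exact: mxE|].
Qed.

Lemma rel_mx_row p q r (E F : R -> 'M[R]_(p, q)) (E' F' : R -> 'M[R]_(p, r)) :
  mrel E F -> mrel E' F' ->
  mrel (fun t => row_mx (E t) (E' t)) (fun t => row_mx (F t) (F' t)).
Proof.
move=> h h'; apply: rel_mx_entries => [t i j|t i j|i j]; [exact: mxE|exact: mxE|].
by move=> /=; case: (fintype.split j) => k; [exact: h|exact: h'].
Qed.

Lemma rel_mx_col p q r (E F : R -> 'M[R]_(q, p)) (E' F' : R -> 'M[R]_(r, p)) :
  mrel E F -> mrel E' F' ->
  mrel (fun t => col_mx (E t) (E' t)) (fun t => col_mx (F t) (F' t)).
Proof.
move=> h h'; apply: rel_mx_entries => [t i j|t i j|i j]; [exact: mxE|exact: mxE|].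
by move=> /=; case: (fintype.split i) => k; [exact: h|exact: h'].
Qed.

Lemma rel_mx_lsub p q r (E F : R -> 'M[R]_(p, q + r)) : mrel E F ->
  mrel (fun t => lsubmx (E t)) (fun t => lsubmx (F t)).
Proof.
by move=> h; apply: rel_mx_entries => [t i j|t i j|i j]; [exact: mxE|exact: mxE|].
Qed.

Lemma rel_mx_rsub p q r (E F : R -> 'M[R]_(p, q + r)) : mrel E F ->
  mrel (fun t => rsubmx (E t)) (fun t => rsubmx (F t)).
Proof.
by move=> h; apply: rel_mx_entries => [t i j|t i j|i j]; [exact: mxE|exact: mxE|].
Qed.

Lemma rel_mx_usub p q r (E F : R -> 'M[R]_(q + r, p)) : mrel E F ->
  mrel (fun t => usubmx (E t)) (fun t => usubmx (F t)).
Proof.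
by move=> h; apply: rel_mx_entries => [t i j|t i j|i j]; [exact: mxE|exact: mxE|].
Qed.

Lemma rel_mx_stack p q m (E F : R -> 'M[R]_(\sum_(k < m) p, q)%N) :
  (forall k, mrel (fun t => blockrow (E t) k) (fun t => blockrow (F t) k)) ->
  mrel E F.
Proof.
have e (M : 'M[R]_(\sum_(k < m) p, q)%N) i j :
    M i j = blockrow M (tagnat.sig1 i) (tagnat.sig2 i) j.
  by rewrite -{1}(submxcolK M) mxE.
move=> h; apply: rel_mx_entries => [t i j|t i j|i j]; [exact: e|exact: e|].
exact: (h (tagnat.sig1 i) (tagnat.sig2 i) j).
Qed.

Lemma rel_mx_trace p (E F : R -> 'M[R]_p) : mrel E F ->
  rel (fun t => \tr (E t)) (fun t => \tr (F t)).
Proof. by move=> h; apply: congr_sum => i; exact: h. Qed.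

Lemma rel_sdot p (E F E' F' : R -> 'cV[R]_p) : mrel E F -> mrel E' F' ->
  rel (fun t => sdot (E t) (E' t)) (fun t => sdot (F t) (F' t)).
Proof. by move=> h h'; apply: rel_mxM => //; exact: rel_mx_tr. Qed.

End MatrixCongruence.

(** Continuity, put in the shape of a relation so that the matrix rules above
    apply to it. *)
Definition continuous_rel T (f g : R -> R) : Prop :=
  {within `[0, T], continuous f}.

Lemma continuous_congruence T : ring_congruence (continuous_rel T).
Proof.
split=> [c|f g cf|f g f' g' cf cf'|f g f' g' cf cf'] t.
- exact: cvg_cst.
- by apply: cvgN; exact: cf.
- by apply: cvgD; [exact: cf|exact: cf'].
- by apply: cvgM; [exact: cf|exact: cf'].
Qed.

Lemma continuous_entries T p q (E : R -> 'M[R]_(p, q)) :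
  {within `[0, T], continuous E} -> rel_mx (continuous_rel T) E E.
Proof.
move=> cE i j t.
apply: (@continuous_comp _ _ _ (E : subspace `[0, T] -> _)
  (fun M : 'M[R]_(p, q) => M i j) t); first exact: cE.
exact: coord_continuous.
Qed.

Lemma entries_continuous T p q (E : R -> 'M[R]_(p, q)) :
  rel_mx (continuous_rel T) E E -> {within `[0, T], continuous E}.
Proof.
move=> cE t; apply/cvg_ballP => e e0; near=> u; split=> // i j.
move: i j; near: u.
by apply: filter_forall => i; apply: filter_forall => j; exact: (cvg_ball (cE i j t)).
Unshelve. all: by end_near. Qed.

(** Lipschitz dependence in a form that composes: with [nu] the distance between
    two solutions, closeness of the vector fields along them is a Lipschitz
    estimate, and the bound on each function makes closeness stable under
    products. *)
Definition close_on T (nu f g : R -> R) : Prop :=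
  exists2 C, 0 <= C & forall t, 0 <= t <= T ->
    [/\ `|f t| <= C, `|g t| <= C & `|f t - g t| <= C * nu t].

Section Closeness.
Variables (T : R) (nu : R -> R).
Hypothesis nu_ge0 : forall t, 0 <= nu t.

Lemma close_congruence : ring_congruence (close_on T nu).
Proof.
split=> [c|f g [C C0 h]|f g f' g' [C C0 h] [C' C'0 h']
        |f g f' g' [C C0 h] [C' C'0 h']].
- by exists `|c| => // t _; rewrite subrr normr0; split => //; exact: mulr_ge0.
- exists C => // t tT; have [h1 h2 h3] := h t tT.
  by rewrite -opprD !normrN.
- exists (C + C') => [|t tT]; first exact: addr_ge0.
  have [h1 h2 h3] := h t tT; have [h1' h2' h3'] := h' t tT.
  split; try by apply: le_trans (ler_normD _ _) _; exact: lerD.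
  have -> : f t + f' t - (g t + g' t) = (f t - g t) + (f' t - g' t) by ring.
  by rewrite mulrDl; apply: le_trans (ler_normD _ _) _; exact: lerD.
- have CC : 0 <= C * C' by exact: mulr_ge0.
  exists (C * C' + C * C') => [|t tT]; first exact: addr_ge0.
  have [h1 h2 h3] := h t tT; have [h1' h2' h3'] := h' t tT.
  split; rewrite ?normrM.
  + by apply: le_trans (ler_pM _ _ h1 h1') _ => //; rewrite lerDl.
  + by apply: le_trans (ler_pM _ _ h2 h2') _ => //; rewrite lerDl.
  have -> : f t * f' t - g t * g' t = (f t - g t) * f' t + g t * (f' t - g' t).
    by ring.
  apply: le_trans (ler_normD _ _) _; rewrite !normrM.
  have := ler_pM (normr_ge0 _) (normr_ge0 _) h3 h1'.
  have := ler_pM (normr_ge0 _) (normr_ge0 _) h2 h3'.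
  lra.
Qed.

Lemma close_mx_congr p q (E F E' F' : R -> 'M[R]_(p, q)) :
  (forall t, 0 <= t <= T -> E t = E' t) ->
  (forall t, 0 <= t <= T -> F t = F' t) ->
  rel_mx (close_on T nu) E' F' -> rel_mx (close_on T nu) E F.
Proof.
move=> hE hF h i j; have [C C0 {}h] := h i j.
by exists C => // t tT; rewrite hE// hF//; exact: h.
Qed.

Lemma close_mx_eq p q (E F : R -> 'M[R]_(p, q)) :
  {within `[0, T], continuous E} ->
  (forall t, 0 <= t <= T -> E t = F t) -> rel_mx (close_on T nu) E F.
Proof.
move=> /continuous_entries cE EF i j.
have [C C0 h] := bounded_on_segment (cE i j); exists C => // t tT.
by rewrite -EF// subrr normr0; split; rewrite ?h//; exact: mulr_ge0.
Qed.

End Closeness.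

(** With the sum of the absolute differences of all entries as gauge [nu],
    closeness of the two vector fields is the Lipschitz hypothesis of
    [backward_gronwall]. One matrix next to a family of matrices of another size
    is the shape of the unknowns of the major player and of the classes of minor
    players; the derivatives are taken entrywise so that transposed solutions
    are covered. *)
Lemma close_ode_unique T (J : finType) p1 q1 p2 q2
    (Z Z' dZ dZ' : R -> 'M[R]_(p1, q1)) (Y Y' dY dY' : J -> R -> 'M[R]_(p2, q2)) :
  (forall t, 0 <= t <= T -> forall i j,
     is_deriv_on T (fun u => Z u i j) t (dZ t i j)) ->
  (forall t, 0 <= t <= T -> forall i j,
     is_deriv_on T (fun u => Z' u i j) t (dZ' t i j)) ->
  (forall k t, 0 <= t <= T -> forall i j,
     is_deriv_on T (fun u => Y k u i j) t (dY k t i j)) ->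
  (forall k t, 0 <= t <= T -> forall i j,
     is_deriv_on T (fun u => Y' k u i j) t (dY' k t i j)) ->
  Z T = Z' T -> (forall j, Y j T = Y' j T) ->
  (forall nu, (forall t, 0 <= nu t) -> rel_mx (close_on T nu) Z Z' ->
     (forall j, rel_mx (close_on T nu) (Y j) (Y' j)) ->
     rel_mx (close_on T nu) dZ dZ' /\ (forall j, rel_mx (close_on T nu) (dY j) (dY' j))) ->
  forall t, 0 <= t <= T -> Z t = Z' t /\ (forall j, Y j t = Y' j t).
Proof.
move=> hZ hZ' hY hY' ZT YT hclose.
pose I := (('I_p1 * 'I_q1) + (J * ('I_p2 * 'I_q2)))%type.
pose z (i : I) t := match i with
  | inl a => Z t a.1 a.2 - Z' t a.1 a.2
  | inr b => Y b.1 t b.2.1 b.2.2 - Y' b.1 t b.2.1 b.2.2 end.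
pose dz (i : I) t := match i with
  | inl a => dZ t a.1 a.2 - dZ' t a.1 a.2
  | inr b => dY b.1 t b.2.1 b.2.2 - dY' b.1 t b.2.1 b.2.2 end.
pose nu t := \sum_i `|z i t|.
have nu0 t : 0 <= nu t by exact: sumr_ge0.
have znu i t : `|z i t| <= nu t.
  by rewrite /nu (bigD1 i)//= lerDl sumr_ge0.
have bound p q (M dM : R -> 'M[R]_(p, q)) i j :
    (forall t, 0 <= t <= T -> forall i j,
       is_deriv_on T (fun u => M u i j) t (dM t i j)) ->
    exists2 C, 0 <= C & forall t, 0 <= t <= T -> `|M t i j| <= C.
  move=> h; apply: bounded_on_segment; apply: is_deriv_on_continuous => t tT.
  by exists (dM t i j); exact: h.
have close0 p q (M N dM dN : R -> 'M[R]_(p, q)) i j :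
    (forall t, 0 <= t <= T -> forall i j,
       is_deriv_on T (fun u => M u i j) t (dM t i j)) ->
    (forall t, 0 <= t <= T -> forall i j,
       is_deriv_on T (fun u => N u i j) t (dN t i j)) ->
    (forall t, `|M t i j - N t i j| <= nu t) ->
    close_on T nu (fun t => M t i j) (fun t => N t i j).
  move=> hM hN MN; have [C C0 bM] := bound _ _ _ _ i j hM.
  have [C' C'0 bN] := bound _ _ _ _ i j hN.
  exists (C + C' + 1) => [|t tT]; first by rewrite !addr_ge0.
  have := bM t tT; have := bN t tT; have := MN t; have := nu0 t.
  by split; nra.
have [|j|cdZ cdY] := hclose nu nu0.
- by move=> i j; apply: close0 hZ hZ' _ => t; exact: (znu (inl (i, j))).
- by move=> a b; apply: close0 (hY j) (hY' j) _ => t; exact: (znu (inr (j, (a, b)))).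
have cdz i : exists C, 0 <= C /\ forall t, 0 <= t <= T -> `|dz i t| <= C * nu t.
  case: i => [[i j]|[j [a b]]].
    by have [C C0 h] := cdZ i j; exists C; split=> // t tT; have [] := h t tT.
  by have [C C0 h] := cdY j a b; exists C; split=> // t tT; have [] := h t tT.
have [C hC] := choice cdz.
have z0 : forall i t, 0 <= t <= T -> z i t = 0.
  apply: (@backward_gronwall T I z dz (\sum_i C i)).
  - by apply: sumr_ge0 => i _; have [] := hC i.
  - case=> [[i j]|[j [a b]]] t tT; apply: is_deriv_onB.
    + exact: hZ.
    + exact: hZ'.
    + exact: hY.
    + exact: hY'.
  - move=> i t tT; have [_ h] := hC i; apply: le_trans (h t tT) _.
    apply: ler_wpM2r; first exact: nu0.
    by rewrite (bigD1 i)//= lerDl; apply: sumr_ge0 => k _; have [] := hC k.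
  - by case=> [[i j]|[j [a b]]]; rewrite /z /= ?ZT ?YT subrr.
move=> t tT; split=> [|j]; apply/matrixP => a b; apply/eqP; rewrite -subr_eq0.
  by rewrite -(z0 (inl (a, b)) t tT).
by rewrite -(z0 (inr (j, (a, b))) t tT).
Qed.

End Gronwall.

(** * Populations and flat derivatives *)

Section Populations.
Context {R : realType} {n : nat}.
Implicit Types (mu nu : P2 R n) (y c : 'cV[R]_n).

Lemma measurable_coord i :
  measurable_fun setT (fun y : borelV R n => (y : 'cV[R]_n) i 0).
Proof. by apply: continuous_borelV; exact: coord_continuous. Qed.

(** A coordinate is dominated by [1 + |y|^2], so the second moment bounds it. *)
Lemma integrable_coord mu i :
  mu.-integrable setT (fun y : borelV R n => ((y : 'cV[R]_n) i 0)%:E).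
Proof.
have sq0 y : 0 <= sqnorm 1%:M y.
  by rewrite sqnorm1E sumr_ge0// => k _; rewrite sqr_ge0.
have msq : measurable_fun setT
    (fun y : borelV R n => (sqnorm 1%:M (y : 'cV[R]_n))%:E).
  apply/measurable_EFinP; apply: continuous_borelV; exact: continuous_sqnorm1.
have isq : mu.-integrable setT
    (fun y : borelV R n => (sqnorm 1%:M (y : 'cV[R]_n))%:E).
  apply/integrableP; split => //.
  under eq_integral do rewrite gee0_abs ?lee_fin//.
  exact: P2_moment.
have i1 := integrableD (measurableT : measurable setT)
  (finite_measure_integrable_cst mu 1 measurableT) isq.
apply: (le_integrable _ _ _ i1) => //.
  by apply/measurable_EFinP; exact: measurable_coord.
move=> y _; rewrite -EFinD !abse_EFin lee_fin.
rewrite [leRHS]ger0_norm ?addr_ge0// sqnorm1E.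
have h : y i 0 ^+ 2 <= \sum_k y k 0 ^+ 2.
  by rewrite (bigD1 i)//= lerDl sumr_ge0// => k _; rewrite sqr_ge0.
apply: le_trans (lerD (lexx 1) h).
rewrite -(real_normK (num_real (y i 0))).
have := sqr_ge0 (`|y i 0| - 2^-1); nra.
Qed.

Lemma integrable_affine mu c (a : R) :
  mu.-integrable setT (fun y : borelV R n => (sdot c (y : 'cV[R]_n) + a)%:E).
Proof.
rewrite (_ : (fun y : borelV R n => _) = (fun y : borelV R n =>
  (\sum_i ((c i 0)%:E * ((y : 'cV[R]_n) i 0)%:E) + a%:E))%E).
  apply: integrableD => //; last exact: finite_measure_integrable_cst.
  apply: integrable_sum => // i _; apply: integrableZl => //.
  exact: integrable_coord.
by apply/funext => y; rewrite sdotE EFinD sumEFin.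
Qed.

Lemma Rintegral_affine mu c (a : R) :
  \int[mu]_y (sdot c (y : 'cV[R]_n) + a) = sdot c (mean mu) + a.
Proof.
have ic := integrable_affine mu c 0.
rewrite RintegralD//; last 2 first.
- move: ic; rewrite (_ : (fun y => _) = EFin \o (fun y : borelV R n => sdot c y))//.
  by apply/funext => y; rewrite addr0.
- exact: finite_measure_integrable_cst.
congr (_ + _); last first.
  by rewrite Rintegral_cst//= probability_setT /= mulr1.
rewrite sdotE /Rintegral.
under eq_integral do rewrite sdotE -sumEFin.
rewrite integral_sum//=; last first.
  move=> i; under eq_fun do rewrite EFinM.
  by apply: integrableZl => //; exact: integrable_coord.
under eq_bigr => i _.
  under eq_integral do rewrite EFinM.
  rewrite integralZl//; last exact: integrable_coord.
  rewrite -(fineK (integrable_fin_num _ (integrable_coord mu i)))// -EFinM.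
  over.
rewrite sumEFin /=; apply: eq_bigr => i _.
by rewrite mxE.
Qed.

(** Means are integrals of signed functions, whose integral against a mixture is
    computed on the positive and negative parts separately. *)
Lemma mean_mix e mu nu : 0 <= e <= 1 ->
  mean (mixP2 e mu nu) = mean mu + e *: (mean nu - mean mu).
Proof.
move=> /andP[e0 e1].
have ce : clamp01 e = e by rewrite /clamp01 min_l// max_r.
apply/colP => i; rewrite !mxE /Rintegral.
set f := fun y : borelV R n => ((y : 'cV[R]_n) i 0)%:E.
have mf : measurable_fun setT f.
  by apply/measurable_EFinP; exact: measurable_coord.
have mixE (g : borelV R n -> \bar R) :
    measurable_fun setT g -> (forall y, (0 <= g y)%E) ->
    (\int[mixP2 e mu nu]_y g y =
     (1 - e)%:E * \int[mu]_y g y + e%:E * \int[nu]_y g y)%E.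
  move=> mg g0; rewrite /= /mix_measure ge0_integral_measure_add//.
  by rewrite !ge0_integral_mscale//= ce.
rewrite ![(\int[_]_y f y)%E]integralE.
rewrite !mixE//; try exact: measurable_funepos; try exact: measurable_funeneg.
have imu := integrable_coord mu i; have inu := integrable_coord nu i.
rewrite -(fineK (integrable_fin_num measurableT (integrable_funepos measurableT imu))).
rewrite -(fineK (integrable_fin_num measurableT (integrable_funepos measurableT inu))).
rewrite -(fineK (integrable_fin_num measurableT (integrable_funeneg measurableT imu))).
rewrite -(fineK (integrable_fin_num measurableT (integrable_funeneg measurableT inu))).
rewrite -!EFinM -!EFinD /=; ring.
Qed.

Lemma dirac_moment y :
  (\int[\d_(y : borelV R n)]_z (sqnorm 1%:M (z : 'cV[R]_n))%:E < +oo)%E.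
Proof.
rewrite integral_dirac//.
  by rewrite diracT mul1e ltry.
by apply/measurable_EFinP; apply: continuous_borelV; exact: continuous_sqnorm1.
Qed.

Definition diracP2 y : P2 R n := MkP2 (dirac_moment y).

Lemma Rintegral_diracP2 y (f : 'cV[R]_n -> R) :
  measurable_fun setT (fun z : borelV R n => f z) ->
  \int[diracP2 y]_z f z = f y.
Proof.
move=> mf; rewrite /Rintegral /= integral_dirac//.
  by rewrite diracT mul1e.
exact/measurable_EFinP.
Qed.

Lemma mean_diracP2 y : mean (diracP2 y) = y.
Proof.
apply/colP => i; rewrite mxE (@Rintegral_diracP2 y (fun z => z i 0))//.
exact: measurable_coord.
Qed.

Lemma blockrowE K q (M : 'M[R]_(\sum_(k < K) n, q)%N) l :
  blockrow M l = blockE n l *m M.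
Proof.
rewrite -{2}(submxcolK M) mul_mxrow_mxcol (bigD1 l)//= eqxx mul1mx.
by rewrite big1 ?addr0// => k /negbTE ->; rewrite mul0mx.
Qed.

Section FlatDerivatives.
Context {K : nat}.
Implicit Types (m : 'I_K -> P2 R n).

Lemma zbar_diracP2 (v : 'cV[R]_(\sum_(k < K) n)%N) :
  zbar (fun k => diracP2 (blockrow v k)) = v.
Proof.
rewrite /zbar -[RHS]submxcolK; apply: eq_mxcol => k.
exact: mean_diracP2.
Qed.

Lemma zbar_upd m l e nu : 0 <= e <= 1 ->
  zbar (upd m l (mixP2 e (m l) nu)) =
  zbar m + e *: ((blockE n l)^T *m (mean nu - mean (m l))).
Proof.
move=> e01; rewrite scalemxAr tr_mxrow mxcol_mul /zbar -mxcolD.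
apply: eq_mxcol => k; rewrite /upd; have [->|kl] := eqVneq k l.
  by rewrite mean_mix// trmx1 mul1mx.
by rewrite trmx0 mul0mx addr0.
Qed.

Variables (P : 'M[R]_(\sum_(k < K) n)%N) (s : 'cV[R]_(\sum_(k < K) n)%N) (r : R).
Variables (U : ('I_K -> P2 R n) -> R).
Hypothesis sP : P^T = P.
Hypothesis UE : forall m, U m = quad P s r (zbar m).

(** The constant gradient of the flat derivative: [U] sees the measures through
    their means only, and means are affine in the measure. *)
Definition flat_slope m l : 'cV[R]_n := blockrow (2 *: (P *m zbar m + s)) l.

(** Along a mixture the vector of means moves on a segment, so the quotient is
    the directional derivative plus [e] times a constant. *)
Lemma cvg_flat_quotient m l nu :
  e^-1 * (U (upd m l (mixP2 e (m l) nu)) - U m) @[e --> 0^'+] -->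
  sdot (flat_slope m l) (mean nu) - sdot (flat_slope m l) (mean (m l)).
Proof.
set v := (blockE n l)^T *m (mean nu - mean (m l)).
have L : (fun e : R => 2 * sdot (P *m zbar m + s) v + e * sqnorm P v) @ 0^'+ -->
    sdot (flat_slope m l) (mean nu) - sdot (flat_slope m l) (mean (m l)).
  have -> : sdot (flat_slope m l) (mean nu) - sdot (flat_slope m l) (mean (m l))
      = 2 * sdot (P *m zbar m + s) v.
    by rewrite -sdotNr -sdotDr /flat_slope blockrowE sdot_mulmx sdotZl.
  rewrite -[X in _ --> X]addr0; apply: cvgD; first exact: cvg_cst.
  rewrite -[X in _ --> X](mul0r (sqnorm P v)); apply: cvgM; last exact: cvg_cst.
  by apply: cvg_within_filter; exact: cvg_id.
apply: cvg_trans L; apply: near_eq_cvg; near=> e => /=.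
have e0 : 0 < e by near: e; exact: nbhs_right_gt.
have e1 : e <= 1 by near: e; exact: nbhs_right_ltW.
rewrite !UE zbar_upd ?(ltW e0)// -/v.
rewrite /quad /sqnorm !(mulmxDr, sdotDl, sdotDr) -!scalemxAr.
rewrite !(sdotZl, sdotZr) (sdot_sym _ _ sP) [sdot v (P *m _)]sdotC (sdot_sym _ _ sP).
field; exact: lt0r_neq0.
Unshelve. all: by end_near. Qed.

Lemma is_flat_deriv_slope m l : is_flat_deriv U m l (sdot (flat_slope m l)).
Proof.
move=> nu; have i0 := integrable_affine nu (flat_slope m l) 0.
split; first by under eq_fun do rewrite -[sdot _ _]addr0.
have iE (mu : P2 R n) : \int[mu]_y sdot (flat_slope m l) y =
    sdot (flat_slope m l) (mean mu).
  have := Rintegral_affine mu (flat_slope m l) 0; rewrite addr0 => <-.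
  by apply: eq_Rintegral => y _; rewrite addr0.
by rewrite !iE; exact: cvg_flat_quotient.
Qed.

(** Testing against point masses determines a flat derivative pointwise, up to
    its additive constant. *)
Lemma flat_deriv_affine m l (D : 'cV[R]_n -> R) : is_flat_deriv U m l D ->
  exists a, D = (fun y => sdot (flat_slope m l) y + a).
Proof.
move=> hD.
exists (\int[m l]_y D y - sdot (flat_slope m l) (mean (m l))).
apply/funext => y; have [iD cD] := hD (diracP2 y).
have := cvg_unique (@norm_hausdorff _ _) cD (@cvg_flat_quotient m l (diracP2 y)).
rewrite Rintegral_diracP2; last first.
  by apply/measurable_EFinP; case/integrableP : iD.
rewrite mean_diracP2 => /(_ _); lra.
Qed.

End FlatDerivatives.
End Populations.

(** * Quadratic value functions along the dynamics *)

Section QuadraticValues.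
Context {R : realType}.

Lemma quadZ p a (P : 'M[R]_p) s r xi :
  a * quad P s r xi = quad (a *: P) (a *: s) (a * r) xi.
Proof. by rewrite /quad /sqnorm -scalemxAl sdotZr sdotZl; ring. Qed.

Definition riccati_rhs p (rho : R) (P a S W : 'M[R]_p) : 'M[R]_p :=
  rho *: P - (P *m a + a^T *m P - P *m S *m P + W).

Definition adjoint_rhs p (rho : R) (P a S : 'M[R]_p) (s m w : 'cV[R]_p) :
    'cV[R]_p :=
  rho *: s - ((a^T - P *m S) *m s + P *m m - w).

Lemma tr_riccati_rhs p rho (P a S W : 'M[R]_p) : S^T = S -> W^T = W ->
  (riccati_rhs rho P a S W)^T = riccati_rhs rho P^T a S W.
Proof.
move=> sS sW; rewrite /riccati_rhs linearB linearZ /= !linearD /= linearN /=.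
by rewrite !trmx_mul trmxK sS sW mulmxA [- (P^T *m a) - _]addrC.
Qed.

(** Both sides of the dynamic programming identity are quadratic polynomials in
    [xi] with symmetric quadratic parts, so [quad_inj] compares them coefficient
    by coefficient. *)
Lemma hjb_riccati p q (rho : R) (P dP a S : 'M[R]_p) (s ds m : 'cV[R]_p)
    (Q : 'M[R]_q) (H : 'M[R]_(q, p)) e r dr c :
    P^T = P -> dP^T = dP -> S^T = S -> Q^T = Q ->
  (forall xi, - quad dP ds dr xi + rho * quad P s r xi =
     2 * sdot (P *m xi + s) (a *m xi + m)
     - sdot (P *m xi + s) (S *m (P *m xi + s))
     + sqnorm Q (H *m xi - e) + c) <->
  [/\ dP = riccati_rhs rho P a S (H^T *m Q *m H),
      ds = adjoint_rhs rho P a S s m (H^T *m Q *m e) &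
      dr = rho * r - (2 * sdot s m - sdot s (S *m s) + sqnorm Q e + c)].
Proof.
move=> sP sdP sS sQ.
have sW : (H^T *m Q *m H)^T = H^T *m Q *m H.
  by rewrite !trmx_mul trmxK sQ mulmxA.
rewrite /adjoint_rhs; set r' := 2 * _ - _ + _ + _.
have E xi : - quad dP ds dr xi + rho * quad P s r xi =
    quad (rho *: P - dP) (rho *: s - ds) (rho * r - dr) xi.
  by rewrite quadZ -quadB addrC.
have subE (V : zmodType) (x y z : V) : x - y = z -> y = x - z.
  by move=> <-; rewrite opprB addrC subrK.
have ham xi := hamiltonian_quad a s m H e c xi sP sS sQ.
split=> [h|[hP hs hr] xi].
  have [| |hP hs hr] := quad_inj _ _
    (fun xi => etrans (esym (E xi)) (etrans (h xi) (ham xi))).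
  - by rewrite linearB linearZ /= sP sdP.
  - by rewrite !linearD /= linearN /= !trmx_mul !trmxK sP sS sQ !mulmxA
      [_ *m P + _]addrC.
  by split; apply: subE.
have subE' (V : zmodType) (x y z : V) : y = x - z -> x - y = z.
  by move=> ->; rewrite opprB addrC subrK.
by rewrite E (subE' _ _ _ _ hP) (subE' _ _ _ _ hs) (subE' _ _ _ _ hr) ham.
Qed.

Lemma is_deriv_on_quad p T (P : R -> 'M[R]_p) s r t dP ds dr xi :
  is_deriv_on T P t dP -> is_deriv_on T s t ds -> is_deriv_on T r t dr ->
  is_deriv_on T (fun u => quad (P u) (s u) (r u) xi) t (quad dP ds dr xi).
Proof.
have sqnE (M : 'M[R]_p) :
    sqnorm M xi = \sum_i xi i 0 * \sum_j xi j 0 * M i j.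
  rewrite /sqnorm sdotE; apply: eq_bigr => i _; rewrite mxE; congr (_ * _).
  by apply: eq_bigr => j _; rewrite mulrC.
have sdotE' (v : 'cV[R]_p) : sdot v xi = \sum_i xi i 0 * v i 0.
  by rewrite sdotC sdotE.
move=> hP hs hr; apply: is_deriv_onD hr; apply: is_deriv_onD.
  have -> : (fun u => sqnorm (P u) xi) =
      (fun u => \sum_i xi i 0 * \sum_j xi j 0 * P u i j) by apply/funext.
  rewrite sqnE; apply: is_deriv_on_sum => i; apply: is_deriv_onZ.
  apply: is_deriv_on_sum => j; apply: is_deriv_onZ; exact: is_deriv_on_entry.
have -> : (fun u => 2 * sdot (s u) xi) = (fun u => 2 * \sum_i xi i 0 * s u i 0).
  by apply/funext => u; rewrite sdotE'.
rewrite sdotE'; apply: is_deriv_onZ.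
by apply: is_deriv_on_sum => i; apply: is_deriv_onZ; exact: is_deriv_on_entry.
Qed.

(** Two equal entries have the same derivative. *)
Lemma is_deriv_on_sym p T (P : R -> 'M[R]_p) t dP : 0 < T -> 0 <= t <= T ->
  (forall u, 0 <= u <= T -> (P u)^T = P u) ->
  is_deriv_on T P t dP -> dP^T = dP.
Proof.
move=> T0 tT sP h; apply/matrixP => i j; rewrite mxE.
have hij := is_deriv_on_entry (i := i) (j := j) h.
have hji := is_deriv_on_entry (i := j) (j := i) h.
apply: (is_deriv_on_unique T0 tT hji); apply: is_deriv_on_ext hij => // u uT.
by rewrite -{1}(sP u uT) mxE.
Qed.

Section Restriction.
Variables (p q : nat) (P : 'M[R]_p) (s : 'cV[R]_p) (r : R).
Variables (E : 'M[R]_(p, q)) (c : 'cV[R]_p).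
Hypothesis sP : P^T = P.

Let sEPE : (E^T *m P *m E)^T = E^T *m P *m E.
Proof. by rewrite !trmx_mul trmxK sP mulmxA. Qed.

Let restrE : (fun x => quad P s r (E *m x + c)) =
  quad (E^T *m P *m E) (E^T *m (P *m c + s)) (quad P s r c).
Proof. by apply/funext => x; rewrite quad_affine. Qed.

Lemma diff2_quad_restr : diff2 (fun x => quad P s r (E *m x + c)).
Proof. by rewrite restrE; exact: diff2_quad. Qed.

Lemma grad_quad_restr x : grad (fun x => quad P s r (E *m x + c)) x =
  2 *: (E^T *m (P *m (E *m x + c) + s)).
Proof. by rewrite restrE grad_quad// !mulmxDr !mulmxA addrA. Qed.

Lemma hess_quad_restr x : hess (fun x => quad P s r (E *m x + c)) x =
  2 *: (E^T *m P *m E).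
Proof. by rewrite restrE hess_quad. Qed.

End Restriction.

Definition inj_up p q : 'M[R]_(p + q, p) := col_mx 1%:M 0.
Definition inj_down p q : 'M[R]_(p + q, q) := col_mx 0 1%:M.

Lemma inj_upE p q (x : 'cV[R]_p) (z : 'cV[R]_q) :
  col_mx x z = inj_up p q *m x + col_mx 0 z.
Proof. by rewrite mul_col_mx mul1mx mul0mx add_col_mx addr0 add0r. Qed.

Lemma inj_downE p q (x : 'cV[R]_q) (z : 'cV[R]_p) :
  col_mx z x = inj_down p q *m x + col_mx z 0.
Proof. by rewrite mul_col_mx mul1mx mul0mx add_col_mx addr0 add0r. Qed.

Lemma tr_inj_up p q m (v : 'M[R]_(p + q, m)) : (inj_up p q)^T *m v = usubmx v.
Proof.
by rewrite -{1}(vsubmxK v) tr_col_mx mul_row_col trmx1 trmx0 mul1mx mul0mx addr0.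
Qed.

Lemma tr_inj_down p q m (v : 'M[R]_(p + q, m)) : (inj_down p q)^T *m v = dsubmx v.
Proof.
by rewrite -{1}(vsubmxK v) tr_col_mx mul_row_col trmx1 trmx0 mul1mx mul0mx add0r.
Qed.

Lemma inj_midE p q m (z : 'cV[R]_p) (x : 'cV[R]_q) (y : 'cV[R]_m) :
  col_mx z (col_mx x y) =
  inj_down p (q + m) *m inj_up q m *m x + col_mx z (col_mx 0 y).
Proof.
rewrite inj_downE inj_upE mulmxDr !mulmxA -addrA; congr (_ + _).
by rewrite -inj_downE.
Qed.

Lemma inj_lastE p q m (z : 'cV[R]_p) (x : 'cV[R]_q) (y : 'cV[R]_m) :
  col_mx z (col_mx x y) =
  inj_down p (q + m) *m inj_down q m *m y + col_mx z (col_mx x 0).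
Proof.
rewrite inj_downE (inj_downE y) mulmxDr !mulmxA -addrA; congr (_ + _).
by rewrite -inj_downE.
Qed.

End QuadraticValues.

Section Transport.
Context {R : realType} {n n1 n2 K : nat} (d : mfg_data R n n1 n2 K).
Local Notation S := (mB d *m invmx (mR d) *m (mB d)^T).

Variables (W : values (R := R) (n := n) (K := K)) (t : R) (x0 : 'cV[R]_n).
Variables (mu : 'I_K -> P2 R n) (g : 'cV[R]_(\sum_(k < K) n)%N).
Variables (dU : 'I_K -> 'cV[R]_n -> R).
Variables (N : 'I_K -> 'M[R]_n) (b : 'I_K -> 'cV[R]_n).
Hypothesis dUE : forall l, exists a, dU l = (fun y => sdot (blockrow g l) y + a).
Hypothesis gradV : forall l y,
  grad (fun z => V_ W l t z x0 mu) y = 2 *: (N l *m y + b l).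

Let affine_quad (c : 'cV[R]_n) (a : R) :
  (fun y => sdot c y + a) = quad 0 (2^-1 *: c) a.
Proof.
apply/funext => y; rewrite /quad /sqnorm mul0mx sdot0r add0r sdotZl mulrA.
by rewrite divff// mul1r.
Qed.

Let grad_dU l y : grad (dU l) y = blockrow g l.
Proof.
have [a ->] := dUE l; rewrite affine_quad grad_quad ?trmx0// mul0mx add0r.
by rewrite scalerA divff// scale1r.
Qed.

Let hess_dU l y : hess (dU l) y = 0.
Proof.
by have [a ->] := dUE l; rewrite affine_quad hess_quad ?trmx0// scaler0.
Qed.

Let driftE l y : drift_integrand d x0 mu dU l y =
  sdot ((mA d l)^T *m blockrow g l) y
  + sdot (blockrow g l) (mG d *m x0 + Fpi d *m zbar mu).
Proof.
by rewrite /drift_integrand grad_dU -addrA sdotDr [in RHS]sdot_mulmx trmxK.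
Qed.

Let controlE l y : control_integrand d W t x0 mu dU l y =
  sdot ((S *m N l)^T *m blockrow g l) y + sdot (blockrow g l) (S *m b l).
Proof.
rewrite /control_integrand grad_dU gradV -scalemxAr sdotZr mulrA mulVf// mul1r.
by rewrite mulmxDr sdotDr [in RHS]sdot_mulmx trmxK -(mulmxA S).
Qed.

Let diffusionE l y : diffusion_integrand d dU l y = 0.
Proof. by rewrite /diffusion_integrand hess_dU !mul0mx mxtrace0 mulr0. Qed.

(** Flat derivatives have a constant gradient and no Hessian, and the optimal
    feedback is affine in [y]: all integrands are affine, and an integral of an
    affine function is its value at the mean. *)
Lemma transportE : transport d W t x0 mu dU =
  \sum_l sdot (blockrow g l)
    (mA d l *m mean (mu l) + (mG d *m x0 + Fpi d *m zbar mu)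
     - S *m (N l *m mean (mu l) + b l)).
Proof.
rewrite /transport -sumrB -big_split /=; apply: eq_bigr => l _.
under [X in X - _ + _]eq_Rintegral do rewrite driftE.
under [X in _ - X + _]eq_Rintegral do rewrite controlE.
under [X in _ - _ + X]eq_Rintegral do rewrite diffusionE.
rewrite !Rintegral_affine Rintegral_cst// mul0r addr0.
rewrite !sdot_mulmx !trmxK !(mulmxDr, sdotDr, sdotNr) -!mulmxA.
ring.
Qed.

Lemma transport_wfP : transport_wf d W t x0 mu dU.
Proof.
move=> l; split.
- have [a ->] := dUE l; rewrite affine_quad; apply: diff2_quad; exact: trmx0.
- under eq_fun do rewrite driftE; exact: integrable_affine.
- under eq_fun do rewrite controlE; exact: integrable_affine.
- under eq_fun do rewrite diffusionE; exact: finite_measure_integrable_cst.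
Qed.

End Transport.

(** * The equilibrium system as differential equations *)

Section Equilibrium.
Context {R : realType} {n n1 n2 K : nat} (d : mfg_data R n n1 n2 K).
Local Notation T := (horizon d).
Local Notation rho := (discount d).
Local Notation R0i := (invmx (mR0 d)).
Local Notation Ri := (invmx (mR d)).
Implicit Types (X Y : nce (R := R) (n := n) (K := K)) (t : R).

Definition gain0 := bbB0 d *m R0i *m (bbB0 d)^T.
Definition gain := bbB d *m Ri *m (bbB d)^T.

Definition P0_rhs X t :=
  riccati_rhs rho (P0_ X t) (bbA0 d X t) gain0 (bbQ0 d).
Definition P_rhs X k t :=
  riccati_rhs rho (P_ X k t) (bbA d X t k) gain (bbQ d).
Definition s0_rhs X t :=
  adjoint_rhs rho (P0_ X t) (bbA0 d X t) gain0 (s0_ X t) (bbM0 X t) (etab0 d).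
Definition s_rhs X k t :=
  adjoint_rhs rho (P_ X k t) (bbA d X t k) gain (s_ X k t) (bbM d X t) (etab d).

(** The algebraic part of the system: the mean field dynamics generated by the
    best responses. *)
Definition consistent X t : Prop := forall k,
  [/\ blockrow (Abar_ X t) k =
        (mA d k - mB d *m Ri *m (mB d)^T *m blk11 (P_ X k t)) *m blockE n k
        + Fpi d - mB d *m Ri *m (mB d)^T *m blk13 (P_ X k t),
      blockrow (Gbar_ X t) k =
        mG d - mB d *m Ri *m (mB d)^T *m blk12 (P_ X k t) &
      blockrow (mbar_ X t) k = - (mB d *m Ri *m (bbB d)^T *m s_ X k t)].

Definition nce_ode X t : Prop :=
  [/\ is_deriv_on T (P0_ X) t (P0_rhs X t),
      forall k, is_deriv_on T (P_ X k) t (P_rhs X k t),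
      is_deriv_on T (s0_ X) t (s0_rhs X t),
      forall k, is_deriv_on T (s_ X k) t (s_rhs X k t) &
      consistent X t].

Definition nce_terminal X : Prop :=
  [/\ P0_ X T = bbQ0f d, forall k, P_ X k T = bbQf d,
      s0_ X T = - etab0f d & forall k, s_ X k T = - etabf d].

Let solve_rhs (V : zmodType) (x dx a b c w : V) :
  x = dx + a + b - c + w <-> dx = x - (a + b - c + w).
Proof.
have -> : dx + a + b - c + w = dx + (a + b - c + w) by rewrite !addrA.
by split=> ->; rewrite ?addrK ?subrK.
Qed.

Let solve_rhs3 (V : zmodType) (x dx a b w : V) :
  x = dx + a + b - w <-> dx = x - (a + b - w).
Proof.
have -> : dx + a + b - w = dx + (a + b - w) by rewrite !addrA.
by split=> ->; rewrite ?addrK ?subrK.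
Qed.

Lemma nce_solutionP X : nce_solution d X <->
  [/\ nce_continuous d X, forall t, 0 <= t <= T -> nce_ode X t &
      nce_terminal X].
Proof.
have e1 t dP0 : rho *: P0_ X t = dP0 + P0_ X t *m bbA0 d X t
      + (bbA0 d X t)^T *m P0_ X t
      - P0_ X t *m bbB0 d *m R0i *m (bbB0 d)^T *m P0_ X t + bbQ0 d <->
    dP0 = P0_rhs X t.
  by rewrite solve_rhs /P0_rhs /riccati_rhs /gain0 !mulmxA.
have e2 t k dP : rho *: P_ X k t = dP + P_ X k t *m bbA d X t k
      + (bbA d X t k)^T *m P_ X k t
      - P_ X k t *m bbB d *m Ri *m (bbB d)^T *m P_ X k t + bbQ d <->
    dP = P_rhs X k t.
  by rewrite solve_rhs /P_rhs /riccati_rhs /gain !mulmxA.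
have e3 t ds0 : rho *: s0_ X t = ds0
      + ((bbA0 d X t)^T - P0_ X t *m bbB0 d *m R0i *m (bbB0 d)^T) *m s0_ X t
      + P0_ X t *m bbM0 X t - etab0 d <->
    ds0 = s0_rhs X t.
  by rewrite solve_rhs3 /s0_rhs /adjoint_rhs /gain0 !mulmxA.
have e4 t k ds : rho *: s_ X k t = ds
      + ((bbA d X t k)^T - P_ X k t *m bbB d *m Ri *m (bbB d)^T) *m s_ X k t
      + P_ X k t *m bbM d X t - etab d <->
    ds = s_rhs X k t.
  by rewrite solve_rhs3 /s_rhs /adjoint_rhs /gain !mulmxA.
split.
  move=> [cX [h1 h2 h3 h4 h5] [g1 g2 g3 g4 g5]]; split=> // t tT; split.
  - by have [dP0 + /e1 <-] := h1 t tT.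
  - by move=> k; have [dP + /e2 <-] := h3 k t tT.
  - by have [dP0 + /e3 <-] := g1 t tT.
  - by move=> k; have [dP + /e4 <-] := g3 k t tT.
  - by move=> k; have [? ?] := h5 k t tT; have ? := g5 k t tT.
move=> [cX hX [T1 T2 T3 T4]]; split=> //; split=> //.
- move=> t /hX [h _ _ _ _]; exists (P0_rhs X t) => //; exact/e1.
- move=> k t /hX [_ h _ _ _]; exists (P_rhs X k t) => //; exact/e2.
- by move=> k t /hX [_ _ _ _ /(_ k) []].
- move=> t /hX [_ _ h _ _]; exists (s0_rhs X t) => //; exact/e3.
- move=> k t /hX [_ _ _ h _]; exists (s_rhs X k t) => //; exact/e4.
- by move=> k t /hX [_ _ _ _ /(_ k) []].
Qed.

Section Congruence.
Variable rel : (R -> R) -> (R -> R) -> Prop.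
Hypothesis rc : ring_congruence rel.
Local Notation mrel := (rel_mx rel).

Lemma riccati_rhs_congr p (S W : 'M[R]_p) P P' a a' :
  mrel P P' -> mrel a a' ->
  mrel (fun t => riccati_rhs rho (P t) (a t) S W)
       (fun t => riccati_rhs rho (P' t) (a' t) S W).
Proof.
move=> hP ha; have cst q r (c : 'M[R]_(q, r)) := rel_mx_cst rc c.
apply: rel_mxB => //; first exact: rel_mxZ.
apply: rel_mxD => //; apply: rel_mxB => //.
  apply: rel_mxD => //; first exact: rel_mxM.
  by apply: rel_mxM => //; exact: rel_mx_tr.
by apply: rel_mxM => //; exact: rel_mxM.
Qed.

Lemma adjoint_rhs_congr p (S : 'M[R]_p) w P P' a a' s s' m m' :
  mrel P P' -> mrel a a' -> mrel s s' -> mrel m m' ->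
  mrel (fun t => adjoint_rhs rho (P t) (a t) S (s t) (m t) w)
       (fun t => adjoint_rhs rho (P' t) (a' t) S (s' t) (m' t) w).
Proof.
move=> hP ha hs hm; have cst q r (c : 'M[R]_(q, r)) := rel_mx_cst rc c.
apply: rel_mxB => //; first exact: rel_mxZ.
apply: rel_mxB => //; apply: rel_mxD => //; last exact: rel_mxM.
apply: rel_mxM => //; apply: rel_mxB => //; first exact: rel_mx_tr.
exact: rel_mxM.
Qed.

Lemma bbA0_congr X Y : mrel (Abar_ X) (Abar_ Y) -> mrel (Gbar_ X) (Gbar_ Y) ->
  mrel (fun t => bbA0 d X t) (fun t => bbA0 d Y t).
Proof.
move=> hA hG; have cst q r (c : 'M[R]_(q, r)) := rel_mx_cst rc c.
apply: rel_mx_col; first exact: cst.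
exact: rel_mx_row.
Qed.

Lemma bbA_congr X Y k :
  mrel (fun t => bbA0 d X t) (fun t => bbA0 d Y t) -> mrel (P0_ X) (P0_ Y) ->
  mrel (fun t => bbA d X t k) (fun t => bbA d Y t k).
Proof.
move=> hA hP; have cst q r (c : 'M[R]_(q, r)) := rel_mx_cst rc c.
apply: rel_mx_col; first exact: cst.
apply: rel_mx_row => //; apply: rel_mxB => //; exact: rel_mxM.
Qed.

Lemma bbM0_congr X Y : mrel (mbar_ X) (mbar_ Y) ->
  mrel (fun t => bbM0 X t) (fun t => bbM0 Y t).
Proof. by move=> hm; apply: rel_mx_col => //; exact: rel_mx_cst. Qed.

Lemma bbM_congr X Y : mrel (mbar_ X) (mbar_ Y) -> mrel (s0_ X) (s0_ Y) ->
  mrel (fun t => bbM d X t) (fun t => bbM d Y t).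
Proof.
move=> hm hs; have cst q r (c : 'M[R]_(q, r)) := rel_mx_cst rc c.
apply: rel_mx_col; first exact: cst.
by apply: rel_mxB => //; [exact: bbM0_congr|exact: rel_mxM].
Qed.

End Congruence.

Lemma consistent_eq X Y t : consistent X t -> consistent Y t ->
  (forall k, P_ X k t = P_ Y k t) ->
  [/\ Abar_ X t = Abar_ Y t, Gbar_ X t = Gbar_ Y t &
      (forall k, s_ X k t = s_ Y k t) -> mbar_ X t = mbar_ Y t].
Proof.
move=> hX hY hP; split=> [||hs]; apply/mxcolP => k;
  have [eA eG em] := hX k; have [eA' eG' em'] := hY k;
  rewrite -/(blockrow _ k) -/(blockrow _ k).
- by rewrite eA eA' hP.
- by rewrite eG eG' hP.
- by rewrite em em' hs.
Qed.

Section Uniqueness.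
Variables X Y : nce (R := R) (n := n) (K := K).
Hypotheses (solX : nce_solution d X) (solY : nce_solution d Y).

(** [Abar] and [Gbar] are affine in the [P_k], so the Riccati equations form a
    closed system with a locally Lipschitz vector field. *)
Lemma riccati_unique t : 0 <= t <= T ->
  P0_ X t = P0_ Y t /\ forall k, P_ X k t = P_ Y k t.
Proof.
move: t; have /nce_solutionP[_ hX [tX1 tX2 _ _]] := solX.
have /nce_solutionP[_ hY [tY1 tY2 _ _]] := solY.
apply: (@close_ode_unique R T 'I_K _ _ _ _ (P0_ X) (P0_ Y) (P0_rhs X) (P0_rhs Y)
  (P_ X) (P_ Y) (P_rhs X) (P_rhs Y)).
- by move=> t /hX[h _ _ _ _] i j; exact: is_deriv_on_entry h.
- by move=> t /hY[h _ _ _ _] i j; exact: is_deriv_on_entry h.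
- by move=> k t /hX[_ h _ _ _] i j; exact: is_deriv_on_entry (h k).
- by move=> k t /hY[_ h _ _ _] i j; exact: is_deriv_on_entry (h k).
- by rewrite tX1 tY1.
- by move=> k; rewrite tX2 tY2.
move=> nu nu0 hP0 hP; have rc := close_congruence T nu0.
have cst q r (c : 'M[R]_(q, r)) := rel_mx_cst rc c.
have hA : rel_mx (close_on T nu) (Abar_ X) (Abar_ Y).
  apply: rel_mx_stack => k; apply: close_mx_congr.
  - by move=> t /hX[_ _ _ _ /(_ k) [-> _ _]].
  - by move=> t /hY[_ _ _ _ /(_ k) [-> _ _]].
  apply: rel_mxB => //.
    apply: rel_mxD => //; apply: rel_mxM => //; apply: rel_mxB => //.
    apply: rel_mxM => //; apply: rel_mx_lsub; exact: rel_mx_usub.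
  apply: rel_mxM => //; apply: rel_mx_rsub; apply: rel_mx_rsub.
  exact: rel_mx_usub.
have hG : rel_mx (close_on T nu) (Gbar_ X) (Gbar_ Y).
  apply: rel_mx_stack => k; apply: close_mx_congr.
  - by move=> t /hX[_ _ _ _ /(_ k) [_ -> _]].
  - by move=> t /hY[_ _ _ _ /(_ k) [_ -> _]].
  apply: rel_mxB => //; apply: rel_mxM => //; apply: rel_mx_lsub.
  by apply: rel_mx_rsub; exact: rel_mx_usub.
have hA0 := bbA0_congr rc hA hG.
by split=> [|k]; apply: riccati_rhs_congr => //; exact: bbA_congr.
Qed.

(** Once the Riccati equations are solved, the second system is linear in
    [s_0, s_k] with known bounded coefficients. *)
Lemma nce_unique : nce_eq_on d X Y.
Proof.
have /nce_solutionP[cX hX [_ _ tX3 tX4]] := solX.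
have /nce_solutionP[cY hY [_ _ tY3 tY4]] := solY.
have AG t : 0 <= t <= T -> Abar_ X t = Abar_ Y t /\ Gbar_ X t = Gbar_ Y t.
  move=> tT; have [_ eP] := riccati_unique tT.
  have [_ _ _ _ fX] := hX t tT; have [_ _ _ _ fY] := hY t tT.
  by have [] := consistent_eq fX fY eP.
have ss : forall t, 0 <= t <= T -> s0_ X t = s0_ Y t /\ forall k, s_ X k t = s_ Y k t.
  apply: (@close_ode_unique R T 'I_K _ _ _ _ (s0_ X) (s0_ Y) (s0_rhs X) (s0_rhs Y)
    (s_ X) (s_ Y) (s_rhs X) (s_rhs Y)).
  - by move=> t /hX[_ _ h _ _] i j; exact: is_deriv_on_entry h.
  - by move=> t /hY[_ _ h _ _] i j; exact: is_deriv_on_entry h.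
  - by move=> k t /hX[_ _ _ h _] i j; exact: is_deriv_on_entry (h k).
  - by move=> k t /hY[_ _ _ h _] i j; exact: is_deriv_on_entry (h k).
  - by rewrite tX3 tY3.
  - by move=> k; rewrite tX4 tY4.
  move=> nu nu0 hs0 hs; have rc := close_congruence T nu0.
  have [[cP0 cP cA cG] _] := cX.
  have hP0 : rel_mx (close_on T nu) (P0_ X) (P0_ Y).
    by apply: close_mx_eq => // t /riccati_unique[].
  have hP k : rel_mx (close_on T nu) (P_ X k) (P_ Y k).
    by apply: close_mx_eq => // t /riccati_unique[].
  have hA : rel_mx (close_on T nu) (Abar_ X) (Abar_ Y).
    by apply: close_mx_eq => // t /AG[].
  have hG : rel_mx (close_on T nu) (Gbar_ X) (Gbar_ Y).
    by apply: close_mx_eq => // t /AG[].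
  have hm : rel_mx (close_on T nu) (mbar_ X) (mbar_ Y).
    apply: rel_mx_stack => k; apply: close_mx_congr.
    - by move=> t /hX[_ _ _ _ /(_ k) [_ _ ->]].
    - by move=> t /hY[_ _ _ _ /(_ k) [_ _ ->]].
    by apply: rel_mxN => //; apply: rel_mxM => //; exact: rel_mx_cst.
  have hA0 := bbA0_congr rc hA hG.
  split=> [|k]; apply: adjoint_rhs_congr => //.
  - exact: bbM0_congr.
  - exact: bbA_congr.
  - exact: bbM_congr.
move=> t tT; have [eP0 eP] := riccati_unique tT; have [es0 es] := ss t tT.
have [_ _ _ _ fX] := hX t tT; have [_ _ _ _ fY] := hY t tT.
by have [eA eG /(_ es) em] := consistent_eq fX fY eP.
Qed.

End Uniqueness.

Section Symmetry.
Hypotheses (sR0 : (mR0 d)^T = mR0 d) (sR : (mR d)^T = mR d).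
Hypotheses (sQ0 : (mQ0 d)^T = mQ0 d) (sQ : (mQ d)^T = mQ d).
Hypotheses (sQ0f : (mQ0f d)^T = mQ0f d) (sQf : (mQf d)^T = mQf d).

Lemma gain0_sym : gain0^T = gain0.
Proof. by rewrite /gain0 !trmx_mul trmxK trmx_inv sR0 mulmxA. Qed.

Lemma gain_sym : gain^T = gain.
Proof. by rewrite /gain !trmx_mul trmxK trmx_inv sR mulmxA. Qed.

Let sandwich_sym p q (Q : 'M[R]_p) (H : 'M[R]_(p, q)) : Q^T = Q ->
  (H^T *m Q *m H)^T = H^T *m Q *m H.
Proof. by move=> sQ'; rewrite !trmx_mul trmxK sQ' mulmxA. Qed.

(** The transposed family solves the same Riccati equations, with the mean
    field coefficients kept fixed. *)
Lemma nce_sym X : nce_solution d X -> forall t, 0 <= t <= T ->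
  (P0_ X t)^T = P0_ X t /\ forall k, (P_ X k t)^T = P_ X k t.
Proof.
move=> /nce_solutionP[[[cP0 cP cA cG] _] hX [tX1 tX2 _ _]] t tT.
suff [e1 e2] : P0_ X t = (P0_ X t)^T /\ forall k, P_ X k t = (P_ X k t)^T.
  by split=> [|k]; [rewrite -e1|rewrite -e2].
move: t tT; apply: (@close_ode_unique R T 'I_K _ _ _ _ (P0_ X)
  (fun t => (P0_ X t)^T) (P0_rhs X) (fun t => (P0_rhs X t)^T)
  (P_ X) (fun k t => (P_ X k t)^T) (P_rhs X) (fun k t => (P_rhs X k t)^T)).
- by move=> t /hX[h _ _ _ _] i j; exact: is_deriv_on_entry h.
- move=> t /hX[h _ _ _ _] i j; rewrite mxE.
  by under eq_fun do rewrite mxE; exact: is_deriv_on_entry h.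
- by move=> k t /hX[_ h _ _ _] i j; exact: is_deriv_on_entry (h k).
- move=> k t /hX[_ h _ _ _] i j; rewrite mxE.
  by under eq_fun do rewrite mxE; exact: is_deriv_on_entry (h k).
- by rewrite tX1 sandwich_sym.
- by move=> k; rewrite tX2 sandwich_sym.
move=> nu nu0 hP0 hP; have rc := close_congruence T nu0.
have hA0 : rel_mx (close_on T nu) (fun t => bbA0 d X t) (fun t => bbA0 d X t).
  by apply: bbA0_congr => //; exact: close_mx_eq.
split=> [|k].
  have -> : (fun t => (P0_rhs X t)^T) =
      fun t => riccati_rhs rho (P0_ X t)^T (bbA0 d X t) gain0 (bbQ0 d).
    by apply/funext => t; rewrite tr_riccati_rhs ?gain0_sym ?sandwich_sym.
  exact: riccati_rhs_congr.
have -> : (fun t => (P_rhs X k t)^T) =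
    fun t => riccati_rhs rho (P_ X k t)^T (bbA d X t k) gain (bbQ d).
  by apply/funext => t; rewrite tr_riccati_rhs ?gain_sym ?sandwich_sym.
by apply: riccati_rhs_congr => //; apply: bbA_congr => //; exact: close_mx_eq.
Qed.

End Symmetry.
End Equilibrium.

(** * Master equations at quadratic value functions *)

Section FlatRestriction.
Context {R : realType} {n K : nat}.
Variables (p : nat) (P : 'M[R]_p) (s : 'cV[R]_p) (r : R).
Variables (E : 'M[R]_(p, \sum_(k < K) n)%N) (c : 'cV[R]_p).
Variables (U : ('I_K -> P2 R n) -> R) (mu : 'I_K -> P2 R n).
Hypothesis sP : P^T = P.
Hypothesis UE : forall m, U m = quad P s r (E *m zbar m + c).

Let slope := 2 *: (E^T *m (P *m (E *m zbar mu + c) + s)).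

Let UE' m : U m = quad (E^T *m P *m E) (E^T *m (P *m c + s)) (quad P s r c) (zbar m).
Proof. by rewrite UE quad_affine. Qed.

Let sEPE : (E^T *m P *m E)^T = E^T *m P *m E.
Proof. by rewrite !trmx_mul trmxK sP mulmxA. Qed.

Let slopeE l : flat_slope (E^T *m P *m E) (E^T *m (P *m c + s)) mu l =
  blockrow slope l.
Proof. by rewrite /flat_slope /slope !mulmxDr !mulmxA addrA. Qed.

Lemma flat_deriv_restr l : is_flat_deriv U mu l (sdot (blockrow slope l)).
Proof. by rewrite -slopeE; exact: is_flat_deriv_slope sEPE UE' _ _. Qed.

Lemma flat_deriv_restr_affine l D : is_flat_deriv U mu l D ->
  exists a, D = (fun y => sdot (blockrow slope l) y + a).
Proof. by move=> /(flat_deriv_affine sEPE UE'); rewrite slopeE. Qed.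

End FlatRestriction.

Section DynamicProgramming.
Context {R : realType} {n n1 n2 K : nat} (d : mfg_data R n n1 n2 K).
Local Notation T := (horizon d).
Local Notation rho := (discount d).
Local Notation nK := (stack n K).
Local Notation R0i := (invmx (mR0 d)).
Local Notation Ri := (invmx (mR d)).
Local Notation S0 := (mB0 d *m R0i *m (mB0 d)^T).
Local Notation S := (mB d *m Ri *m (mB d)^T).
Implicit Types (X Y : nce (R := R) (n := n) (K := K)).

Lemma gain0_col (a : 'cV[R]_n) (b : 'cV[R]_nK) :
  gain0 d *m col_mx a b = col_mx (S0 *m a) 0.
Proof.
rewrite /gain0 /bbB0 tr_col_mx trmx0 -!mulmxA mul_row_col mul0mx addr0.
by rewrite mul_col_mx mul0mx.
Qed.

Lemma gain_col (a : 'cV[R]_n) (b : 'cV[R]_(n + nK)) :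
  gain d *m col_mx a b = col_mx (S *m a) 0.
Proof.
rewrite /gain /bbB tr_col_mx trmx0 -!mulmxA mul_row_col mul0mx addr0.
by rewrite mul_col_mx mul0mx.
Qed.

Lemma bbA0_col X t (x0 : 'cV[R]_n) (z : 'cV[R]_nK) :
  bbA0 d X t *m col_mx x0 z + bbM0 X t =
  col_mx (mA0 d *m x0 + F0pi d *m z)
         (Gbar_ X t *m x0 + Abar_ X t *m z + mbar_ X t).
Proof. by rewrite mul_block_col add_col_mx addr0. Qed.

Lemma bbA_col X k t (z x0 : 'cV[R]_n) (y : 'cV[R]_nK) :
  bbA d X t k *m col_mx z (col_mx x0 y) + bbM d X t =
  col_mx (mA d k *m z + mG d *m x0 + Fpi d *m y)
    (bbA0 d X t *m col_mx x0 y + bbM0 X t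
     - gain0 d *m (P0_ X t *m col_mx x0 y + s0_ X t)).
Proof.
rewrite mul_block_col add_col_mx mul_row_col mul0mx add0r addr0 addrA.
congr col_mx; rewrite mulmxBl mulmxDr -/(gain0 d) -!mulmxA opprD.
by rewrite -!addrA; congr (_ + _); rewrite addrCA.
Qed.

Lemma hamiltonian0E X t (a x0 : 'cV[R]_n) (b z : 'cV[R]_nK) :
  sdot (2 *: a) (mA0 d *m x0 + F0pi d *m z)
  - 4^-1 * sdot (2 *: a) (S0 *m (2 *: a))
  + sdot (2 *: b) (Gbar_ X t *m x0 + Abar_ X t *m z + mbar_ X t) =
  2 * sdot (col_mx a b) (bbA0 d X t *m col_mx x0 z + bbM0 X t)
  - sdot (col_mx a b) (gain0 d *m col_mx a b).
Proof.
rewrite bbA0_col gain0_col !sdot_col sdot0r addr0 -scalemxAr !sdotZl !sdotZr.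
by field.
Qed.

Lemma hamiltonianE X k t (a b z x0 : 'cV[R]_n) (c y : 'cV[R]_nK) :
  sdot (2 *: b) (mA0 d *m x0 + F0pi d *m y)
  - 2^-1 * sdot (2 *: b)
      (S0 *m (2 *: usubmx (P0_ X t *m col_mx x0 y + s0_ X t)))
  + sdot (2 *: a) (mA d k *m z + mG d *m x0 + Fpi d *m y)
  - 4^-1 * sdot (2 *: a) (S *m (2 *: a))
  + sdot (2 *: c) (Gbar_ X t *m x0 + Abar_ X t *m y + mbar_ X t) =
  2 * sdot (col_mx a (col_mx b c))
        (bbA d X t k *m col_mx z (col_mx x0 y) + bbM d X t)
  - sdot (col_mx a (col_mx b c)) (gain d *m col_mx a (col_mx b c)).
Proof.
rewrite bbA_col bbA0_col gain_col -[X in gain0 d *m X]vsubmxK gain0_col.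
rewrite opp_col_mx add_col_mx oppr0 addr0 !sdot_col sdot0r addr0 -!scalemxAr.
rewrite !sdotZl !sdotZr !sdotDr !sdotNr.
by field.
Qed.

Lemma rowQ0E (x0 : 'cV[R]_n) (z : 'cV[R]_nK) e :
  x0 - Gam0pi d *m z - e = rowQ0 d *m col_mx x0 z - e.
Proof. by rewrite mul_row_col mul1mx mulNmx. Qed.

Lemma rowQ0fE (x0 : 'cV[R]_n) (z : 'cV[R]_nK) e :
  x0 - Gam0fpi d *m z - e = rowQ0f d *m col_mx x0 z - e.
Proof. by rewrite mul_row_col mul1mx mulNmx. Qed.

Lemma rowQE (z x0 : 'cV[R]_n) (y : 'cV[R]_nK) e :
  z - Gam1 d *m x0 - Gam2pi d *m y - e = rowQ d *m col_mx z (col_mx x0 y) - e.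
Proof. by rewrite !mul_row_col mul1mx !mulNmx addrA. Qed.

Lemma rowQfE (z x0 : 'cV[R]_n) (y : 'cV[R]_nK) e :
  z - Gam1f d *m x0 - Gam2fpi d *m y - e = rowQf d *m col_mx z (col_mx x0 y) - e.
Proof. by rewrite !mul_row_col mul1mx !mulNmx addrA. Qed.

Local Notation inj0 := (inj_up n nK).
Local Notation injz := (inj_up n (n + nK)).
Local Notation injx := (inj_down n (n + nK) *m inj_up n nK).
Local Notation injm := (inj_down n (n + nK) *m inj_down n nK).

Let tr_injx (v : 'cV[R]_(n + (n + nK))) : injx^T *m v = usubmx (dsubmx v).
Proof. by rewrite trmx_mul -mulmxA tr_inj_down tr_inj_up. Qed.

Let tr_injm (v : 'cV[R]_(n + (n + nK))) : injm^T *m v = dsubmx (dsubmx v).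
Proof. by rewrite trmx_mul -mulmxA !tr_inj_down. Qed.

(** The diffusion terms, which do not depend on the state because Hessians of
    quadratic functions are constant; they enter only the scalar equations for
    the constant coefficients, whose source terms follow. *)
Definition noise0 X t : R :=
  2^-1 * \tr (2 *: (inj0^T *m P0_ X t *m inj0) *m mD0 d *m (mD0 d)^T).
Definition noise X k t : R :=
  2^-1 * \tr (2 *: (injx^T *m P_ X k t *m injx) *m mD0 d *m (mD0 d)^T)
  + 2^-1 * \tr (2 *: (injz^T *m P_ X k t *m injz) *m mD d *m (mD d)^T).
Definition source0 X t : R :=
  2 * sdot (s0_ X t) (bbM0 X t) - sdot (s0_ X t) (gain0 d *m s0_ X t)
  + sqnorm (mQ0 d) (eta0 d) + noise0 X t.
Definition source X k t : R :=
  2 * sdot (s_ X k t) (bbM d X t) - sdot (s_ X k t) (gain d *m s_ X k t)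
  + sqnorm (mQ d) (eta d) + noise X k t.

Section FixedTime.
Variables (X : nce (R := R) (n := n) (K := K)) (r0 : R -> R) (r : 'I_K -> R -> R).
Variables (W : values (R := R) (n := n) (K := K)) (t : R).
Hypothesis tT : 0 <= t <= T.
Hypothesis qf : has_quadratic_form d W (Coeffs (P0_ X) (P_ X) (s0_ X) (s_ X) r0 r).
Hypothesis sP0 : (P0_ X t)^T = P0_ X t.
Hypothesis sP : forall k, (P_ X k t)^T = P_ X k t.
Hypothesis cX : consistent d X t.

Local Notation costate0 xi := (P0_ X t *m xi + s0_ X t).
Local Notation costate k xi := (P_ X k t *m xi + s_ X k t).

Let V0E x0 mu : V0_ W t x0 mu =
  quad (P0_ X t) (s0_ X t) (r0 t) (col_mx x0 (zbar mu)).
Proof. exact: qf.1. Qed.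

Let VE k z x0 mu : V_ W k t z x0 mu =
  quad (P_ X k t) (s_ X k t) (r k t) (col_mx z (col_mx x0 (zbar mu))).
Proof. exact: qf.2. Qed.

Let V0xE mu : (fun x => V0_ W t x mu) = (fun x =>
  quad (P0_ X t) (s0_ X t) (r0 t) (inj0 *m x + col_mx 0 (zbar mu))).
Proof. by apply/funext => x; rewrite V0E inj_upE. Qed.

Let VzE k x0 mu : (fun z => V_ W k t z x0 mu) = (fun z =>
  quad (P_ X k t) (s_ X k t) (r k t) (injz *m z + col_mx 0 (col_mx x0 (zbar mu)))).
Proof. by apply/funext => z; rewrite VE inj_upE. Qed.

Let VxE k z mu : (fun x => V_ W k t z x mu) = (fun x =>
  quad (P_ X k t) (s_ X k t) (r k t) (injx *m x + col_mx z (col_mx 0 (zbar mu)))).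
Proof. by apply/funext => x; rewrite VE inj_midE. Qed.

Let grad_V0 x0 mu : grad (fun x => V0_ W t x mu) x0 =
  2 *: usubmx (costate0 (col_mx x0 (zbar mu))).
Proof. by rewrite V0xE grad_quad_restr// tr_inj_up -inj_upE. Qed.

Let grad_Vz k z x0 mu : grad (fun y => V_ W k t y x0 mu) z =
  2 *: usubmx (costate k (col_mx z (col_mx x0 (zbar mu)))).
Proof. by rewrite VzE grad_quad_restr// tr_inj_up -inj_upE. Qed.

Let grad_Vx k z x0 mu : grad (fun x => V_ W k t z x mu) x0 =
  2 *: usubmx (dsubmx (costate k (col_mx z (col_mx x0 (zbar mu))))).
Proof. by rewrite VxE grad_quad_restr// tr_injx -inj_midE. Qed.

Let grad_affine x0 mu l y : grad (fun z => V_ W l t z x0 mu) y =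
  2 *: (usubmx (P_ X l t *m injz) *m y
        + usubmx (costate l (col_mx 0 (col_mx x0 (zbar mu))))).
Proof.
rewrite grad_Vz inj_upE mulmxDr -addrA; congr (2 *: _).
by rewrite linearD /= mulmxA -!mul_usub_mx.
Qed.

(** Averaging the optimally controlled dynamics of a class against its
    population measure yields the mean field dynamics. *)
Lemma transport_consistent x0 mu (g : 'cV[R]_nK) dU :
  (forall l, exists a, dU l = (fun y => sdot (blockrow g l) y + a)) ->
  transport d W t x0 mu dU =
  sdot g (Gbar_ X t *m x0 + Abar_ X t *m zbar mu + mbar_ X t).
Proof.
move=> dUE; rewrite (transportE d dUE (grad_affine x0 mu)) sdot_stack.
apply: eq_bigr => l _; congr sdot.
have [eA eG em] := cX l.
have ez : blockE n l *m zbar mu = mean (mu l).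
  by rewrite -blockrowE; exact: mxcolK.
have eP : usubmx (P_ X l t *m injz) *m mean (mu l)
    + usubmx (costate l (col_mx 0 (col_mx x0 (zbar mu)))) =
    blk11 (P_ X l t) *m mean (mu l) + blk12 (P_ X l t) *m x0
    + blk13 (P_ X l t) *m zbar mu + usubmx (s_ X l t).
  transitivity (usubmx (costate l (col_mx (mean (mu l)) (col_mx x0 (zbar mu))))).
    by rewrite [in RHS]inj_upE mulmxDr -addrA [in RHS]linearD /= mulmxA -!mul_usub_mx.
  rewrite linearD /= -mul_usub_mx -[usubmx (P_ X l t)]hsubmxK mul_row_col.
  by rewrite -[rsubmx (usubmx (P_ X l t))]hsubmxK mul_row_col addrA.
have -> : blockrow (Gbar_ X t *m x0 + Abar_ X t *m zbar mu + mbar_ X t) l =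
    blockrow (Gbar_ X t) l *m x0 + blockrow (Abar_ X t) l *m zbar mu
    + blockrow (mbar_ X t) l by rewrite !blockrowE !mulmxDr !mulmxA.
have es : mB d *m Ri *m (bbB d)^T *m s_ X l t = S *m usubmx (s_ X l t).
  by rewrite -{1}(vsubmxK (s_ X l t)) tr_col_mx trmx0 -!mulmxA mul_row_col
    mul0mx addr0.
rewrite eP eA eG em es !(mulmxDl, mulNmx) -!(mulmxA _ (blockE n l)) !ez.
rewrite !mulmxDr !mulmxA !opprD !addrA.
by rewrite [RHS](ACl (3*1*5*4*2*6*7)).
Qed.

(** Drift, control and transport terms assemble into one Hamiltonian for the
    joint state [xi], because each partial gradient is a block of the costate. *)
Lemma master0_rhsE x0 mu dU :
  (forall l, is_flat_deriv (V0_ W t x0) mu l (dU l)) ->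
  let gx := grad (fun x => V0_ W t x mu) x0 in
  let xi := col_mx x0 (zbar mu) in
  sdot gx (mA0 d *m x0 + F0pi d *m zbar mu) - 4^-1 * sdot gx (S0 *m gx)
  + sqnorm (mQ0 d) (x0 - Gam0pi d *m zbar mu - eta0 d)
  + 2^-1 * \tr (hess (fun x => V0_ W t x mu) x0 *m mD0 d *m (mD0 d)^T)
  + transport d W t x0 mu dU =
  2 * sdot (costate0 xi) (bbA0 d X t *m xi + bbM0 X t)
  - sdot (costate0 xi) (gain0 d *m costate0 xi)
  + sqnorm (mQ0 d) (rowQ0 d *m xi - eta0 d) + noise0 X t.
Proof.
move=> flat gx xi.
have UE m : V0_ W t x0 m =
    quad (P0_ X t) (s0_ X t) (r0 t) (inj_down n nK *m zbar m + col_mx x0 0).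
  by rewrite V0E inj_downE.
rewrite (@transport_consistent x0 mu (2 *: dsubmx (costate0 xi))); last first.
  move=> l; have := flat_deriv_restr_affine sP0 UE (flat l).
  by rewrite -inj_downE tr_inj_down.
rewrite /gx grad_V0 rowQ0E -/xi V0xE hess_quad_restr// -/(noise0 X t).
rewrite -[costate0 xi in RHS]vsubmxK -hamiltonian0E.
ring.
Qed.

Lemma flat_deriv_V0 x0 mu l : is_flat_deriv (V0_ W t x0) mu l
  (sdot (blockrow (2 *: dsubmx (costate0 (col_mx x0 (zbar mu)))) l)).
Proof.
have UE m : V0_ W t x0 m =
    quad (P0_ X t) (s0_ X t) (r0 t) (inj_down n nK *m zbar m + col_mx x0 0).
  by rewrite V0E inj_downE.
by have := flat_deriv_restr mu sP0 UE l; rewrite -inj_downE tr_inj_down.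
Qed.

(** As in [master0_rhsE], the major player's optimal feedback now being part of
    the dynamics of the joint state. *)
Lemma master_rhsE k z x0 mu dU :
  (forall l, is_flat_deriv (V_ W k t z x0) mu l (dU l)) ->
  let gx := grad (fun x => V_ W k t z x mu) x0 in
  let gz := grad (fun y => V_ W k t y x0 mu) z in
  let xi := col_mx z (col_mx x0 (zbar mu)) in
  sdot gx (mA0 d *m x0 + F0pi d *m zbar mu)
  - 2^-1 * sdot gx (S0 *m grad (fun x => V0_ W t x mu) x0)
  + 2^-1 * \tr (hess (fun x => V_ W k t z x mu) x0 *m mD0 d *m (mD0 d)^T)
  + sdot gz (mA d k *m z + mG d *m x0 + Fpi d *m zbar mu)
  - 4^-1 * sdot gz (S *m gz)
  + sqnorm (mQ d) (z - Gam1 d *m x0 - Gam2pi d *m zbar mu - eta d)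
  + 2^-1 * \tr (hess (fun y => V_ W k t y x0 mu) z *m mD d *m (mD d)^T)
  + transport d W t x0 mu dU =
  2 * sdot (costate k xi) (bbA d X t k *m xi + bbM d X t)
  - sdot (costate k xi) (gain d *m costate k xi)
  + sqnorm (mQ d) (rowQ d *m xi - eta d) + noise X k t.
Proof.
move=> flat gx gz xi.
have UE m : V_ W k t z x0 m =
    quad (P_ X k t) (s_ X k t) (r k t) (injm *m zbar m + col_mx z (col_mx x0 0)).
  by rewrite VE inj_lastE.
rewrite (@transport_consistent x0 mu (2 *: dsubmx (dsubmx (costate k xi)))); last first.
  move=> l; have := flat_deriv_restr_affine (sP k) UE (flat l).
  by rewrite -inj_lastE tr_injm.
rewrite /gx /gz grad_V0 grad_Vz grad_Vx rowQE -/xi VxE VzE !hess_quad_restr//.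
rewrite -[costate k xi in RHS]vsubmxK -[dsubmx (costate k xi) in RHS]vsubmxK.
rewrite -hamiltonianE /noise.
ring.
Qed.

Lemma flat_deriv_V k z x0 mu l : is_flat_deriv (V_ W k t z x0) mu l
  (sdot (blockrow (2 *: dsubmx (dsubmx
     (costate k (col_mx z (col_mx x0 (zbar mu)))))) l)).
Proof.
have UE m : V_ W k t z x0 m =
    quad (P_ X k t) (s_ X k t) (r k t) (injm *m zbar m + col_mx z (col_mx x0 0)).
  by rewrite VE inj_lastE.
by have := flat_deriv_restr mu (sP k) UE l; rewrite -inj_lastE tr_injm.
Qed.

Lemma transport_wf_slope x0 mu (g : 'cV[R]_nK) :
  transport_wf d W t x0 mu (fun l => sdot (blockrow g l)).
Proof.
apply: (transport_wfP d _ (grad_affine x0 mu)) => l.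
by exists 0; apply/funext => y; rewrite addr0.
Qed.

Lemma diff2_V0 mu : diff2 (fun x => V0_ W t x mu).
Proof. by rewrite V0xE; exact: diff2_quad_restr. Qed.

Lemma diff2_Vx k z mu : diff2 (fun x => V_ W k t z x mu).
Proof. by rewrite VxE; exact: diff2_quad_restr. Qed.

Lemma diff2_Vz k x0 mu : diff2 (fun y => V_ W k t y x0 mu).
Proof. by rewrite VzE; exact: diff2_quad_restr. Qed.

End FixedTime.
End DynamicProgramming.

(** * The correspondence *)

Section Correspondence.
Context {R : realType} {n n1 n2 K : nat} (d : mfg_data R n n1 n2 K).
Local Notation T := (horizon d).
Local Notation rho := (discount d).
Local Notation nK := (stack n K).
Local Notation R0i := (invmx (mR0 d)).
Local Notation Ri := (invmx (mR d)).
Local Notation S := (mB d *m Ri *m (mB d)^T).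
Implicit Types (X Y : nce (R := R) (n := n) (K := K)).
Implicit Types (W : values (R := R) (n := n) (K := K)).
Implicit Types (C : coeffs (R := R) (n := n) (K := K)).

Hypotheses (T_gt0 : 0 < T) (rho_ge0 : 0 <= rho).
Hypotheses (sR0 : (mR0 d)^T = mR0 d) (sR : (mR d)^T = mR d).
Hypotheses (sQ0 : (mQ0 d)^T = mQ0 d) (sQ : (mQ d)^T = mQ d).
Hypotheses (sQ0f : (mQ0f d)^T = mQ0f d) (sQf : (mQf d)^T = mQf d).

Let TT : 0 <= T <= T.
Proof. by rewrite lexx ltW. Qed.

Definition coeffs_of X r0 r : coeffs := Coeffs (P0_ X) (P_ X) (s0_ X) (s_ X) r0 r.

(** The algebraic equations leave no choice for [Abar], [Gbar] and [mbar] once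
    the coefficients of the value functions are given. *)
Definition nce_of C : nce := NCE (Pd0 C) (Pd C)
  (fun t => \mxcol_(k < K) ((mA d k - S *m blk11 (Pd C k t)) *m blockE n k
     + Fpi d - S *m blk13 (Pd C k t)))
  (fun t => \mxcol_(k < K) (mG d - S *m blk12 (Pd C k t)))
  (sd0 C) (sd C)
  (fun t => \mxcol_(k < K) - (mB d *m Ri *m (bbB d)^T *m sd C k t)).

Lemma consistent_nce_of C t : consistent d (nce_of C) t.
Proof. by move=> k; split; exact: mxcolK. Qed.

Lemma nce_of_continuous C : coeffs_wf d C -> nce_continuous d (nce_of C).
Proof.
move=> [_ _ [dP0 dP] [ds0 ds] _].
have der_cont (V : normedModType R) (f : R -> V) :
    derivable_on T f -> {within `[0, T], continuous f}.
  by move=> h; exact: is_deriv_on_continuous.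
have rc := continuous_congruence T.
have cst p q (c : 'M[R]_(p, q)) := rel_mx_cst rc c.
have cP k := continuous_entries (der_cont _ _ (dP k)).
have cs k := continuous_entries (der_cont _ _ (ds k)).
split; split; try by [exact: (der_cont _ _ dP0)|exact: (der_cont _ _ ds0)
  |move=> k; exact: (der_cont _ _ (dP k))|move=> k; exact: (der_cont _ _ (ds k))].
- apply: entries_continuous; apply: rel_mx_stack => k.
  have -> : (fun t => blockrow (Abar_ (nce_of C) t) k) = fun t =>
      (mA d k - S *m blk11 (Pd C k t)) *m blockE n k
       + Fpi d - S *m blk13 (Pd C k t).
    by apply/funext => t; exact: mxcolK.
  apply: rel_mxB => //.
    apply: rel_mxD => //; apply: rel_mxM => //; apply: rel_mxB => //.
    by apply: rel_mxM => //; apply: rel_mx_lsub; exact: rel_mx_usub.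
  apply: rel_mxM => //; apply: rel_mx_rsub; apply: rel_mx_rsub.
  exact: rel_mx_usub.
- apply: entries_continuous; apply: rel_mx_stack => k.
  have -> : (fun t => blockrow (Gbar_ (nce_of C) t) k) = fun t =>
      mG d - S *m blk12 (Pd C k t).
    by apply/funext => t; exact: mxcolK.
  apply: rel_mxB => //; apply: rel_mxM => //; apply: rel_mx_lsub.
  by apply: rel_mx_rsub; exact: rel_mx_usub.
- apply: entries_continuous; apply: rel_mx_stack => k.
  have -> : (fun t => blockrow (mbar_ (nce_of C) t) k) = fun t =>
      - (mB d *m Ri *m (bbB d)^T *m sd C k t).
    by apply/funext => t; exact: mxcolK.
  by apply: rel_mxN => //; exact: rel_mxM.
Qed.

Definition constants_ode X r0 r t : Prop :=
  is_deriv_on T r0 t (rho * r0 t - source0 d X t) /\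
  forall k, is_deriv_on T (r k) t (rho * r k t - source d X k t).

Definition constants_terminal (r0 : R -> R) (r : 'I_K -> R -> R) : Prop :=
  r0 T = sqnorm (mQ0f d) (eta0f d) /\
  forall k, r k T = sqnorm (mQf d) (etaf d).

Section FromQuadratic.
Variables (W : values (R := R) (n := n) (K := K)).
Variables (X : nce (R := R) (n := n) (K := K)) (r0 : R -> R) (r : 'I_K -> R -> R).
Hypothesis cX : forall t, consistent d X t.
Hypothesis qW : quadratic_solution d W (coeffs_of X r0 r).

(** The means of point masses reach every vector, so the master equations hold
    as polynomial identities in a free joint state and [hjb_riccati] applies. *)
Lemma quadratic_ode t : 0 <= t <= T -> nce_ode d X t /\ constants_ode X r0 r t.
Proof.
move=> tT; have [[[mast0 _] mast] [sP0 sP [dP0 dP] [ds0 ds] [dr0 dr]] qf] := qW.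
have [dP0t hP0] := dP0 t tT; have [ds0t hs0] := ds0 t tT.
have [dr0t hr0] := dr0 t tT.
have sdP0 := is_deriv_on_sym T_gt0 tT sP0 hP0.
have [eP0 es0 er0] : [/\ dP0t = P0_rhs d X t, ds0t = s0_rhs d X t &
    dr0t = rho * r0 t - source0 d X t].
  have hjb := @hjb_riccati R _ _ rho (P0_ X t) dP0t (bbA0 d X t) (gain0 d)
    (s0_ X t) ds0t (bbM0 X t) (mQ0 d) (rowQ0 d) (eta0 d) (r0 t) dr0t
    (noise0 d X t) (sP0 t tT) sdP0 (gain0_sym sR0) sQ0.
  apply: (hjb.1 _) => xi; pose x0 := usubmx xi.
  pose mu k : P2 R n := diracP2 (blockrow (dsubmx xi) k).
  have xiE : col_mx x0 (zbar mu) = xi by rewrite zbar_diracP2 vsubmxK.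
  have [_ [dt [dU [ht flat _ eqV]]]] := mast0 t x0 mu tT.
  have dtE : dt = quad dP0t ds0t dr0t xi.
    apply: (is_deriv_on_unique T_gt0 tT ht).
    have := is_deriv_on_quad (xi := xi) hP0 hs0 hr0; apply: is_deriv_on_ext => // u uT.
    by rewrite (qf.1 u x0 mu uT) xiE.
  have := master0_rhsE tT qf (sP0 t tT) (fun k => sP k t tT) (cX t) flat.
  rewrite /= xiE -eqV => <-.
  by rewrite dtE (qf.1 t x0 mu tT) xiE.
have eqk k dPt dst drt : is_deriv_on T (P_ X k) t dPt ->
    is_deriv_on T (s_ X k) t dst -> is_deriv_on T (r k) t drt ->
    [/\ dPt = P_rhs d X k t, dst = s_rhs d X k t &
        drt = rho * r k t - source d X k t].
  move=> hP hs hr; have sdP := is_deriv_on_sym T_gt0 tT (sP k) hP.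
  have hjb := @hjb_riccati R _ _ rho (P_ X k t) dPt (bbA d X t k) (gain d)
    (s_ X k t) dst (bbM d X t) (mQ d) (rowQ d) (eta d) (r k t) drt
    (noise d X k t) (sP k t tT) sdP (gain_sym sR) sQ.
  apply: (hjb.1 _) => xi; pose z := usubmx xi; pose x0 := usubmx (dsubmx xi).
  pose mu k : P2 R n := diracP2 (blockrow (dsubmx (dsubmx xi)) k).
  have xiE : col_mx z (col_mx x0 (zbar mu)) = xi.
    by rewrite zbar_diracP2 !vsubmxK.
  have [_ _ [dt [dU [ht flat _ eqV]]]] := (mast k).1 t z x0 mu tT.
  have dtE : dt = quad dPt dst drt xi.
    apply: (is_deriv_on_unique T_gt0 tT ht).
    have := is_deriv_on_quad (xi := xi) hP hs hr; apply: is_deriv_on_ext => // u uT.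
    by rewrite (qf.2 k u z x0 mu uT) xiE.
  have := master_rhsE tT qf (sP0 t tT) (fun k => sP k t tT) (cX t) flat.
  rewrite /= xiE -eqV => <-.
  by rewrite dtE (qf.2 k t z x0 mu tT) xiE.
split; last first.
  split=> [|k]; first by rewrite -er0.
  have [dPt hP] := dP k t tT; have [dst hs] := ds k t tT.
  by have [drt hr] := dr k t tT; have [_ _ <-] := eqk k _ _ _ hP hs hr.
split=> // [|k||k].
- by rewrite -eP0.
- have [dPt hP] := dP k t tT; have [dst hs] := ds k t tT.
  by have [drt hr] := dr k t tT; have [<- _ _] := eqk k _ _ _ hP hs hr.
- by rewrite -es0.
- have [dPt hP] := dP k t tT; have [dst hs] := ds k t tT.
  by have [drt hr] := dr k t tT; have [_ <- _] := eqk k _ _ _ hP hs hr.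
Qed.

Lemma quadratic_terminal : nce_terminal d X /\ constants_terminal r0 r.
Proof.
have [[[_ term0] mast] [sP0 sP _ _ _] qf] := qW.
have sandwich p q (Q : 'M[R]_p) (H : 'M[R]_(p, q)) : Q^T = Q ->
    (H^T *m Q *m H)^T = H^T *m Q *m H.
  by move=> hQ; rewrite !trmx_mul trmxK hQ mulmxA.
have [eP0 es0 er0] : [/\ P0_ X T = bbQ0f d, s0_ X T = - etab0f d &
    r0 T = sqnorm (mQ0f d) (eta0f d)].
  apply: quad_inj => [||xi]; [exact: sP0|exact: sandwich|].
  rewrite -sqnorm_affine// -(vsubmxK xi) -[dsubmx xi]zbar_diracP2 -rowQ0fE.
  by rewrite -term0 (qf.1 _ _ _ TT).
have eqk k : [/\ P_ X k T = bbQf d, s_ X k T = - etabf d &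
    r k T = sqnorm (mQf d) (etaf d)].
  apply: quad_inj => [||xi]; [exact: sP|exact: sandwich|].
  rewrite -sqnorm_affine// -(vsubmxK xi) -[dsubmx xi]vsubmxK.
  rewrite -[dsubmx (dsubmx xi)]zbar_diracP2 -rowQfE.
  by rewrite -(mast k).2 (qf.2 _ _ _ _ _ TT).
by split; split=> // k; have [] := eqk k.
Qed.

End FromQuadratic.

Lemma quadratic_to_nce W C : quadratic_solution d W C ->
  [/\ nce_solution d (nce_of C),
      forall t, 0 <= t <= T -> constants_ode (nce_of C) (rd0 C) (rd C) t &
      constants_terminal (rd0 C) (rd C)].
Proof.
case: C => P0 P s0 s r0 r qW; have [_ wf _] := qW.
have cX t := consistent_nce_of (Coeffs P0 P s0 s r0 r) t.
have qW' : quadratic_solution d W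
  (coeffs_of (nce_of (Coeffs P0 P s0 s r0 r)) r0 r) := qW.
have ode := quadratic_ode cX qW'; have [term cterm] := quadratic_terminal qW'.
split=> // [|t /ode[]//].
by apply/nce_solutionP; split=> // [|t /ode[]//]; exact: nce_of_continuous.
Qed.

(** Only the constant coefficients are missing from the equilibrium; they solve
    scalar linear equations with continuous source. *)
Lemma nce_to_quadratic X : nce_solution d X ->
  exists W C, quadratic_solution d W C.
Proof.
move=> solX; have sym := nce_sym sR0 sR sQ0 sQ sQ0f sQf solX.
have /nce_solutionP[[[cP0 cP cA cG] [cs0 cs cm]] ode [tP0 tP ts0 ts]] := solX.
have rc := continuous_congruence T.
have cst p q (c : 'M[R]_(p, q)) := rel_mx_cst rc c.
have num (c : R) : continuous_rel T (fun=> c) (fun=> c) := congr_cst rc c.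
have eP0 := continuous_entries cP0; have eP k := continuous_entries (cP k).
have es0 := continuous_entries cs0; have es k := continuous_entries (cs k).
have em := continuous_entries cm.
have eM0 := bbM0_congr rc em; have eM := bbM_congr d rc em es0.
have relB f g : continuous_rel T f f -> continuous_rel T g g ->
    continuous_rel T (fun t => f t - g t) (fun t => f t - g t).
  by move=> hf hg; apply: (congrD rc) => //; exact: (congrN rc).
have trc p (M : R -> 'M[R]_p) (E : 'M[R]_(p, n)) (D : 'M[R]_(n, n2)) :
    rel_mx (continuous_rel T) M M ->
    continuous_rel T (fun t => 2^-1 * \tr (2 *: (E^T *m M t *m E) *m D *m D^T))
                     (fun t => 2^-1 * \tr (2 *: (E^T *m M t *m E) *m D *m D^T)).
  move=> hM; apply: (congrM rc) => //; apply: (rel_mx_trace rc).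
  apply: rel_mxM => //; apply: rel_mxM => //; apply: rel_mxZ => //.
  by apply: rel_mxM => //; exact: rel_mxM.
have lin p (S' : 'M[R]_p) s m : rel_mx (continuous_rel T) s s ->
    rel_mx (continuous_rel T) m m ->
    continuous_rel T (fun t => 2 * sdot (s t) (m t) - sdot (s t) (S' *m s t))
                     (fun t => 2 * sdot (s t) (m t) - sdot (s t) (S' *m s t)).
  move=> hs hm; apply: relB; first by apply: (congrM rc) => //; exact: rel_sdot.
  by apply: rel_sdot => //; exact: rel_mxM.
have csrc0 : {within `[0, T], continuous (source0 d X)}.
  apply: (congrD rc (f' := noise0 d X) (g' := noise0 d X)); last exact: trc.
  by apply: (congrD rc) => //; exact: lin.
have csrc k : {within `[0, T], continuous (source d X k)}.
  apply: (congrD rc (f' := noise d X k) (g' := noise d X k)).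
    by apply: (congrD rc) => //; exact: lin.
  by apply: (congrD rc); exact: trc.
have [r0 [tr0 hr0]] := linear_ode_exists rho (sqnorm (mQ0f d) (eta0f d)) T_gt0 csrc0.
have [r hr] := choice (fun k =>
  linear_ode_exists rho (sqnorm (mQf d) (etaf d)) T_gt0 (csrc k)).
pose W := Values
  (fun t x0 mu => quad (P0_ X t) (s0_ X t) (r0 t) (col_mx x0 (zbar mu)))
  (fun k t z x0 mu => quad (P_ X k t) (s_ X k t) (r k t)
     (col_mx z (col_mx x0 (zbar mu)))).
have qf : has_quadratic_form d W (coeffs_of X r0 r) by [].
exists W, (coeffs_of X r0 r); split=> //.
- split=> [|k]; split.
  + move=> t x0 mu tT; have [sP0 sP] := sym t tT.
    have [dP0 _ ds0 _ cX] := ode t tT.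
    have sdP0 := is_deriv_on_sym T_gt0 tT (fun u uT => (sym u uT).1) dP0.
    split; first exact: diff2_V0 tT qf sP0 _.
    have flat := flat_deriv_V0 tT qf sP0 x0 mu.
    exists (quad (P0_rhs d X t) (s0_rhs d X t) (rho * r0 t - source0 d X t)
      (col_mx x0 (zbar mu))).
    eexists; split; [|exact: flat|exact: transport_wf_slope tT qf sP _ _ _|].
      by apply: is_deriv_on_quad => //; exact: hr0.
    rewrite (master0_rhsE tT qf sP0 sP cX flat).
    have hjb := @hjb_riccati R _ _ rho (P0_ X t) (P0_rhs d X t) (bbA0 d X t)
      (gain0 d) (s0_ X t) (s0_rhs d X t) (bbM0 X t) (mQ0 d) (rowQ0 d) (eta0 d)
      (r0 t) (rho * r0 t - source0 d X t) (noise0 d X t) sP0 sdP0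
      (gain0_sym sR0) sQ0.
    exact: hjb.2.
  + move=> x0 mu; rewrite rowQ0fE sqnorm_affine//.
    by rewrite /W /= tP0 ts0 tr0.
  + move=> t z x0 mu tT; have [sP0 sP] := sym t tT.
    have [_ dP _ ds cX] := ode t tT.
    have sdP := is_deriv_on_sym T_gt0 tT (fun u uT => (sym u uT).2 k) (dP k).
    split; [exact: diff2_Vx tT qf sP _ _ _|exact: diff2_Vz tT qf sP _ _ _|].
    have flat := flat_deriv_V tT qf sP k z x0 mu.
    exists (quad (P_rhs d X k t) (s_rhs d X k t) (rho * r k t - source d X k t)
      (col_mx z (col_mx x0 (zbar mu)))).
    eexists; split; [|exact: flat|exact: transport_wf_slope tT qf sP _ _ _|].
      by apply: is_deriv_on_quad => //; exact: (hr k).2.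
    rewrite (master_rhsE tT qf sP0 sP cX flat).
    have hjb := @hjb_riccati R _ _ rho (P_ X k t) (P_rhs d X k t) (bbA d X t k)
      (gain d) (s_ X k t) (s_rhs d X k t) (bbM d X t) (mQ d) (rowQ d) (eta d)
      (r k t) (rho * r k t - source d X k t) (noise d X k t) (sP k) sdP
      (gain_sym sR) sQ.
    exact: hjb.2.
  + move=> z x0 mu; rewrite rowQfE sqnorm_affine//.
    by rewrite /W /= tP ts (hr k).1.
- split; try split.
  + by move=> t /sym[h _]; exact: h.
  + by move=> k t /sym[_ h]; exact: h.
  + by move=> t /ode[h _ _ _ _]; eexists; exact: h.
  + by move=> k t /ode[_ h _ _ _]; eexists; exact: h.
  + by move=> t /ode[_ _ h _ _]; eexists; exact: h.
  + by move=> k t /ode[_ _ _ h _]; eexists; exact: h.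
  + by move=> t /hr0 h; eexists; exact: h.
  + by move=> k t /(hr k).2 h; eexists; exact: h.
Qed.

(** The quadratic and linear coefficients come from the unique equilibrium, and
    the constant ones from the scalar linear equations it determines. *)
Lemma quadratic_unique W C W' C' :
  quadratic_solution d W C -> quadratic_solution d W' C' -> values_eq_on d W W'.
Proof.
move=> qW qW'; have [solX odeX [t0 tk]] := quadratic_to_nce qW.
have [solY odeY [t0' tk']] := quadratic_to_nce qW'.
have XY := nce_unique solX solY.
have er0 : forall t, 0 <= t <= T -> rd0 C t = rd0 C' t.
  apply: (@linear_ode_unique R T rho (source0 d (nce_of C))) => //.
  - by move=> t /odeX[].
  - move=> t tT; have [h _] := odeY t tT; have [[eP _ _ _] [es _ em]] := XY t tT.
    by rewrite /source0 /noise0 /bbM0 eP es em.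
  - by rewrite t0 t0'.
have er k : forall t, 0 <= t <= T -> rd C k t = rd C' k t.
  apply: (@linear_ode_unique R T rho (source d (nce_of C) k)) => //.
  - by move=> t /odeX[_ /(_ k)].
  - move=> t tT; have [_ h] := odeY t tT; have [[_ eP _ _] [es0 es em]] := XY t tT.
    by rewrite /source /noise /bbM /bbM0 eP es0 es em; exact: h.
  - by rewrite tk tk'.
have [_ _ [qf0 qf]] := qW; have [_ _ [qf0' qf']] := qW'.
move=> t tT; have [[eP0 eP _ _] [es0 es _]] := XY t tT; split.
  move=> x0 mu; rewrite qf0// qf0'// er0//.
  by rewrite [Pd0 C t]eP0 [sd0 C t]es0.
move=> k z x0 mu; rewrite qf// qf'// er//.
by rewrite [Pd C k t]eP [sd C k t]es.
Qed.

Lemma quadratic_coeffs_match X W C :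
  nce_solution d X -> quadratic_solution d W C -> coeffs_match d X C.
Proof.
move=> solX /quadratic_to_nce[solY _ _] t tT.
by have [[? ? _ _] [? ? _]] := nce_unique solX solY tT.
Qed.

End Correspondence.

Theorem theorem4 (R : realType) (n n1 n2 K : nat) (d : mfg_data R n n1 n2 K)
    (n_gt0 : (0 < n)%N) (n1_gt0 : (0 < n1)%N) (n2_gt0 : (0 < n2)%N)
    (K_gt0 : (0 < K)%N)
    (T_gt0 : 0 < horizon d) (rho_ge0 : 0 <= discount d)
    (weight_gt0 : forall k : 'I_K, 0 < weight d 0 k)
    (weight_sum : \sum_(k < K) weight d 0 k = 1)
    (Q0_psd : psdmx (mQ0 d)) (Q0f_psd : psdmx (mQ0f d))
    (Q_psd : psdmx (mQ d)) (Qf_psd : psdmx (mQf d))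
    (R0_pd : pdmx (mR0 d)) (R_pd : pdmx (mR d)) :
  ((exists X, nce_solution d X) <->
   (exists W : values (R := R) (n := n) (K := K), exists C,
      quadratic_solution d W C)) /\
  (forall X Y, nce_solution d X -> nce_solution d Y -> nce_eq_on d X Y) /\
  (forall W C W' C', quadratic_solution d W C -> quadratic_solution d W' C' ->
     values_eq_on d W W') /\
  (forall X W C, nce_solution d X -> quadratic_solution d W C ->
     coeffs_match d X C).
Proof.
have [sQ0 _] := Q0_psd; have [sQ0f _] := Q0f_psd.
have [sQ _] := Q_psd; have [sQf _] := Qf_psd.
have [sR0 _] := R0_pd; have [sR _] := R_pd.
have to_nce W C (q : quadratic_solution d W C) :=
  quadratic_to_nce T_gt0 sR0 sR sQ0 sQ sQ0f sQf q.
split; first split.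
- by move=> [X solX]; exact: nce_to_quadratic T_gt0 sR0 sR sQ0 sQ sQ0f sQf X solX.
- by move=> [W [C /to_nce[sol _ _]]]; exists (nce_of d C).
split; first by move=> X Y; exact: nce_unique.
split.
- move=> W C W' C'.
  exact: quadratic_unique T_gt0 rho_ge0 sR0 sR sQ0 sQ sQ0f sQf W C W' C'.
- move=> X W C.
  exact: quadratic_coeffs_match T_gt0 sR0 sR sQ0 sQ sQ0f sQf X W C.
Qed.
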